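(* Any nonlocal product Hamiltonian $H$ can reversibly simulate any other nonlocal product Hamiltonian $H'$ (possibly acting on systems of different dimensions), with optimal simulation rate $$\gamma_{H'|H}=\frac{K_\otimes(H)}{K_\otimes(H')},$$ so that in particular $\gamma_{H'|H}\gamma_{H|H'}=1$.
   Context: All Hamiltonians are Hermitian operators on finite-dimensional Hilbert spaces. A bipartite Hamiltonian acts on $\mathcal H_A\otimes\mathcal H_B$, with system $A$ held by Alice and $B$ by Bob; it is local if it has the form $H_A\otimes I_B+I_A\otimes H_B$ and nonlocal otherwise. Simulation model: given a bipartite Hamiltonian $H$, Alice and Bob may attach or discard local ancillary systems of arbitrary finite dimension (on which $H$ acts trivially), apply arbitrary instantaneous local unitaries $U_A\otimes U_B$ (each acting on that party's system together with their ancillas), and switch $H$ on for chosen time intervals; the goal is to track (stroboscopically, for arbitrarily finely spaced times) the evolution $e^{-iH't}$ of a target bipartite Hamiltonian $H'$. The simulation rate $\gamma_{H'|H}$ is the supremum of $\gamma\ge 0$ such that evolution under $H'$ for any time $t$ can be achieved in this way (in the limit of arbitrarily fine time slicing) using $H$ for total time $t/\gamma$. $H$ and $H'$ simulate each other reversibly if $\gamma_{H|H'}\gamma_{H'|H}=1$. A product Hamiltonian is $H=H_A\otimes H_B$ with $H_A$, $H_B$ Hermitian on $\mathcal H_A$, $\mathcal H_B$; $\Delta_A$ (resp. $\Delta_B$) denotes the difference between the largest and smallest eigenvalues of $H_A$ (resp. $H_B$), and $K_\otimes(H)=\tfrac14\Delta_A\Delta_B$. *)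

(* Defs.v *)
From HB Require Import structures.
From mathcomp Require Import all_boot all_order all_algebra.
From mathcomp Require Import complex mxtens.
From mathcomp Require Import all_classical all_reals all_analysis.

Set Implicit Arguments.
Unset Strict Implicit.
Unset Printing Implicit Defensive.

Import Order.TTheory GRing.Theory Num.Theory.
Import numFieldNormedType.Exports.
Local Open Scope ring_scope.

Section HamSim.
Variable R : realType.
Local Notation C := R[i].

Definition adjmx m n (A : 'M[C]_(m, n)) : 'M[C]_(n, m) := (map_mx Num.conj A)^T.

Definition herm_mx n (A : 'M[C]_n) : Prop := adjmx A = A.

Definition unitary_mx n (U : 'M[C]_n) : Prop := U *m adjmx U = 1%:M.

Definition expmx n (A : 'M[C]_n) : 'M[C]_n :=
  limn (fun N => \sum_(k < N) (k`!%:R)^-1 *: A ^+ k).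

Definition evol n (H : 'M[C]_n) (t : R) : 'M[C]_n :=
  expmx ((- Complex 0 t) *: H).

(* difference between largest and smallest eigenvalues of a Hermitian matrix
   (whose eigenvalues are real) *)
Definition spread n (A : 'M[C]_n) : R :=
  sup [set complex.Re a | a in [set a : C | eigenvalue A a]]
  - inf [set complex.Re a | a in [set a : C | eigenvalue A a]].

Definition Kprod dA dB (HA : 'M[C]_dA) (HB : 'M[C]_dB) : R :=
  (spread HA * spread HB) / 4%:R.

Definition local_ham dA dB (H : 'M[C]_(dA * dB)) : Prop :=
  exists (HA : 'M[C]_dA) (HB : 'M[C]_dB),
    herm_mx HA /\ herm_mx HB /\ H = HA *t 1%:M + 1%:M *t HB.

Definition nonlocal_ham dA dB (H : 'M[C]_(dA * dB)) : Prop :=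
  ~ local_ham H.

(* Simulation protocols.
   Target systems A' (dim dA') and B' (dim dB'). Alice's lab is
   A' (x) X with X = A (x) a  (resource system A of dim dA and ancilla a of
   dim na); Bob's lab is B' (x) Y with Y = B (x) b. The global space is
   (A' (x) (A (x) a)) (x) (B' (x) (B (x) b)), with the index conventions of
   mxtens (row-major Kronecker product).                                   *)

Section Protocol.
Variables (dA dB dA' dB' na nb : nat).
Local Notation nX := (dA * na).
Local Notation nY := (dB * nb).
Local Notation nAl := (dA' * nX).
Local Notation nBo := (dB' * nY).
Local Notation N := (nAl * nBo).

(* H acting on the A and B factors, identity on A', a, B', b *)
Definition embedH (H : 'M[C]_(dA * dB)) : 'M[C]_N :=
  \matrix_(k, l)
    let: (x, y) := mxtens_unindex k in
    let: (x', y') := mxtens_unindex l in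
    let: (xt, xX) := mxtens_unindex x in
    let: (yt, yY) := mxtens_unindex y in
    let: (xt', xX') := mxtens_unindex x' in
    let: (yt', yY') := mxtens_unindex y' in
    let: (xA, xa) := mxtens_unindex xX in
    let: (yB, yb) := mxtens_unindex yY in
    let: (xA', xa') := mxtens_unindex xX' in
    let: (yB', yb') := mxtens_unindex yY' in
    if [&& xt == xt', yt == yt', xa == xa' & yb == yb']
    then H (mxtens_index (xA, yB)) (mxtens_index (xA', yB'))
    else 0.

Definition step_op (H : 'M[C]_(dA * dB)) (s : R * ('M[C]_nAl * 'M[C]_nBo)) :
  'M[C]_N := (s.2.1 *t s.2.2) *m evol (embedH H) s.1.

Definition prot_op (H : 'M[C]_(dA * dB)) (U0 : 'M[C]_nAl * 'M[C]_nBo)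
  (ss : seq (R * ('M[C]_nAl * 'M[C]_nBo))) : 'M[C]_N :=
  foldl (fun W s => step_op H s *m W) (U0.1 *t U0.2) ss.

Definition prot_valid (U0 : 'M[C]_nAl * 'M[C]_nBo)
  (ss : seq (R * ('M[C]_nAl * 'M[C]_nBo))) : Prop :=
  unitary_mx U0.1 /\ unitary_mx U0.2 /\
  (forall s, s \in ss -> 0 <= s.1 /\ unitary_mx s.2.1 /\ unitary_mx s.2.2).

Definition prot_time (ss : seq (R * ('M[C]_nAl * 'M[C]_nBo))) : R :=
  \sum_(s <- ss) s.1.

Definition gidx (i : 'I_(dA' * dB')) (u : 'I_nX) (v : 'I_nY) : 'I_N :=
  mxtens_index (mxtens_index ((mxtens_unindex i).1, u),
                mxtens_index ((mxtens_unindex i).2, v)).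

(* channel on A'B' induced by the global unitary W: the blocks X, Y start in
   their basis state |0>, W is applied, and X, Y are traced out *)
Definition induced_channel (W : 'M[C]_N) (rho : 'M[C]_(dA' * dB')) :
  'M[C]_(dA' * dB') :=
  let rhoext : 'M[C]_N :=
    \matrix_(k, l)
      let: (x, y) := mxtens_unindex k in
      let: (x', y') := mxtens_unindex l in
      let: (xt, xX) := mxtens_unindex x in
      let: (yt, yY) := mxtens_unindex y in
      let: (xt', xX') := mxtens_unindex x' in
      let: (yt', yY') := mxtens_unindex y' in
      if [&& val xX == 0%N, val yY == 0%N, val xX' == 0%N & val yY' == 0%N]
      then rho (mxtens_index (xt, yt)) (mxtens_index (xt', yt'))
      else 0 in
  let out := W *m rhoext *m adjmx W in
  \matrix_(i, j) \sum_(u < nX) \sum_(v < nY) out (gidx i u v) (gidx j u v).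

End Protocol.

Definition unitary_channel n (V : 'M[C]_n) (rho : 'M[C]_n) : 'M[C]_n :=
  V *m rho *m adjmx V.

Definition chan_close n (Phi Psi : 'M[C]_n -> 'M[C]_n) (eps : R) : Prop :=
  forall i j k l : 'I_n,
    `| Phi (delta_mx i j) k l - Psi (delta_mx i j) k l | <= eps%:C%C.

Definition achievable_rate dA dB dA' dB' (H : 'M[C]_(dA * dB))
  (H' : 'M[C]_(dA' * dB')) (gamma : R) : Prop :=
  0 < gamma /\
  forall t : R, 0 <= t -> forall eps : R, 0 < eps ->
    exists (na nb : nat) (U0 : 'M[C]_(dA' * (dA * na)) * 'M[C]_(dB' * (dB * nb)))
      (ss : seq (R * ('M[C]_(dA' * (dA * na)) * 'M[C]_(dB' * (dB * nb))))),
      prot_valid U0 ss /\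
      prot_time ss <= t / gamma /\
      chan_close (induced_channel (prot_op H U0 ss))
                 (unitary_channel (evol H' t)) eps.

Definition sim_rate dA dB dA' dB' (H : 'M[C]_(dA * dB))
  (H' : 'M[C]_(dA' * dB')) : R :=
  sup [set g : R | achievable_rate H H' g].

End HamSim.

(* Main.v *)
(* Write H = HA *t HB with HA = al + h x and HB = be + g y, where x and y are
   contractions with extreme eigenvalues 1 and -1.  Up to commuting local terms
   H is K (x *t y) with K = h g = Kprod HA HB.

   Upper bound.  The trace norm of a bipartite pure state (the sum of its
   Schmidt coefficients) is unchanged by local unitaries, and evolving under H
   for a time s multiplies it by at most exp (K s), because applying x *t y does
   not increase it.  Here it is handled by duality, through rows that are
   bounded on products of unit vectors.  On the other hand exp (- i t H') maps a
   suitable product state to cos (K' t) |++> - i sin (K' t) |-->, of trace norm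
   cos (K' t) + sin (K' t); this is detected on the target systems alone by a
   fixed observable, so the bound does not depend on the size of the ancillas.
   Hence (cos (K' t) + sin (K' t)) ^ 2 <= exp (2 K t / gamma) for all t >= 0, and
   t -> 0 gives gamma <= K / K'.

   Lower bound.  The simulation is exact, without time slicing.  Conditionally
   on the eigenvector j of HA' present in the target system, Alice puts the
   system A into the eigenvector of HA of maximal or minimal eigenvalue, and Bob
   does the same with B.  Averaging these choices over the steps with product
   weights yields any prescribed affine function of the eigenvalues of HA' and
   HB', that is, H' up to local phases, in total time t K' / K. *)
Require Import Defs.
From HB Require Import structures.
From mathcomp Require Import all_boot all_order all_algebra.
From mathcomp Require Import complex mxtens.
From mathcomp Require Import all_classical all_reals all_analysis.
From mathcomp Require Import fingroup perm ring lra.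
Import Order.TTheory GRing.Theory Num.Theory.
Local Open Scope ring_scope.
Import numFieldNormedType.Exports.
Set Implicit Arguments.
Unset Strict Implicit.
Unset Printing Implicit Defensive.
Local Open Scope classical_set_scope.
Local Open Scope complex_scope.

(** * Matrix exponentials of Hermitian matrices *)

Section Phases.
Variable R : realType.
Local Notation C := (R[i] : numFieldType).
Implicit Types (x y : R).

Definition cis x : C := cos x +i* sin x.

Lemma cisD x y : cis (x + y) = cis x * cis y.
Proof. by rewrite /cis cosD sinD; simpc; congr (_ +i* _); ring. Qed.

Lemma cis0 : cis 0 = 1.
Proof. by rewrite /cis cos0 sin0. Qed.

Lemma conj_cis x : Num.conj (cis x) = cis (- x).
Proof. by rewrite /cis cosN sinN. Qed.

Lemma cisN x : cis (- x) * cis x = 1.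
Proof. by rewrite -cisD addNr cis0. Qed.

Lemma norm_cis x : `|cis x| = 1.
Proof. by rewrite normc_def /= cos2Dsin2 sqrtr1. Qed.

Lemma cvg_complex (u v : R^nat) (a b : R) : u @ \oo --> a -> v @ \oo --> b ->
  (fun n => u n +i* v n : C) @ \oo --> (a +i* b : C).
Proof.
(* A positive element of [C] is real, so the complex radius may be replaced by a real one and split
   in two halves. *)
move=> ua vb; apply/cvgrPdist_lt => -[e e'] /[dup] /gtr0_real.
rewrite complex_real => /eqP -> e0; rewrite ltcR in e0.
have e2 : 0 < e / 2 by rewrite divr_gt0.
have /cvgrPdist_lt/(_ _ e2) ua' := ua.
have /cvgrPdist_lt/(_ _ e2) vb' := vb.
near=> n.
have -> : (a +i* b : C) - (u n +i* v n) = (a - u n)%:C + 'i * (b - v n)%:C.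
  by simpc.
apply: le_lt_trans (ler_normD _ _) _.
rewrite normrM !normc_def /= !(expr0n, expr1n, addr0, add0r) /= sqrtr1 mul1r.
rewrite !sqrtr_sqr -rmorphD ltcR (splitr e) ltrD//; near: n.
  exact: ua'.
exact: vb'.
Unshelve. all: by end_near. Qed.

Definition exp_sum (N : nat) (z : C) : C := \sum_(k < N) (k`!%:R)^-1 * z ^+ k.

Lemma expi_even x k : ('i * x%:C : C) ^+ k.*2 = ((-1) ^+ k * x ^+ k.*2)%:C.
Proof.
rewrite exprMn -mul2n exprM sqr_i !rmorphM /= !rmorphXn /=.
by rewrite rmorphN1.
Qed.

Lemma exp_sum_im N x : exp_sum N ('i * x%:C) =
  series (cos_coeff x) N +i* series (sin_coeff x) N.
Proof.
elim: N => [|N IH].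
  by rewrite /exp_sum /series /= big_ord0 !big_geq.
rewrite /exp_sum big_ord_recr /= -/(exp_sum N _) IH.
rewrite !seriesSr /=.
have -> : (N`!%:R^-1 : C) = (N`!%:R^-1)%:C by rewrite fmorphV rmorph_nat.
rewrite /cos_coeff /sin_coeff /=.
(* Even powers of ['i * x] feed the cosine series and odd ones the sine series; for odd [N] the
   exponent [N.-1./2] in the sine coefficient agrees with [N./2]. *)
have := odd_double_half N; case: (odd N) => /= NE.
  have {1}-> : ('i * x%:C : C) ^+ N = ('i : C) * (((-1) ^+ N./2 * x ^+ N)%:C).
    rewrite -{1}NE add1n exprS expi_even -mulrA -rmorphM /=.
    congr (_ * _); congr (_ %:C).
    by rewrite mulrCA -exprS -add1n NE.
  have -> : N.-1./2 = N./2 by rewrite -{1}NE add1n /= doubleK.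
  rewrite -exprnP; simpc; congr (_ +i* _); by field; exact: lt0r_neq0.
have {1}-> : ('i * x%:C : C) ^+ N = ((-1) ^+ N./2 * x ^+ N)%:C.
  by rewrite -{1 3}NE add0n expi_even.
rewrite -exprnP; simpc; congr (_ +i* _); by field; exact: lt0r_neq0.
Qed.

Lemma cvg_exp_sum x : (exp_sum ^~ ('i * x%:C)) @ \oo --> cis x.
Proof.
under eq_fun do rewrite exp_sum_im.
apply: cvg_complex.
  by rewrite unlock; exact: is_cvg_series_cos_coeff.
by rewrite unlock; exact: is_cvg_series_sin_coeff.
Qed.

End Phases.

(** * Entrywise limits of matrices *)

Section MatrixLimits.
Variable K : numFieldType.

(** A neighbourhood of a matrix contains a box with one condition per entry, and finitely many
    eventual conditions hold together eventually. *)
Lemma cvg_mx m n (F : nat -> 'M[K]_(m, n)) (L : 'M[K]_(m, n)) :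
  (forall i j, (fun N => F N i j) @ \oo --> L i j) -> F @ \oo --> L.
Proof.
move=> FL A [P LP sPA].
have : \forall N \near \oo, forall i j, P i j (F N i j).
  apply: filter_forall => i; apply: filter_forall => j.
  exact: (FL i j _ (LP i j)).
by apply: filterS => N FP; apply: sPA.
Qed.

Lemma limn_mx m n (F : nat -> 'M[K]_(m, n)) (L : 'M[K]_(m, n)) :
  (forall i j, (fun N => F N i j) @ \oo --> L i j) -> limn F = L.
Proof.
move=> FL; have FlimF : F @ \oo --> limn F by apply/cvg_ex; exists L; exact: cvg_mx.
apply/matrixP => i j.
suff : (fun N => F N i j) @ \oo --> limn F i j.
  by move=> /(cvg_unique _) /(_ (FL i j)); apply; exact: norm_hausdorff.
(* Coordinate projections are continuous: this box constrains the entry [(i, j)] only. Uniqueness of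
   limits can then be used in the scalar field. *)
move=> A LA; apply: (FlimF [set M | A (M i j)]).
exists (fun i' j' => if (i' == i) && (j' == j) then A else setT).
  move=> i' j'; case: ifP => [/andP[/eqP -> /eqP ->] //|_].
  exact: filterT.
by move=> M /(_ i j); rewrite !eqxx.
Qed.

Lemma cvg_lincomb (I : Type) (r : seq I) (c : I -> K) (f : I -> nat -> K)
    (l : I -> K) : (forall i, f i @ \oo --> l i) ->
  (fun N => \sum_(i <- r) c i * f i N) @ \oo --> \sum_(i <- r) c i * l i.
Proof.
move=> fl; elim: r => [|i r IH].
  by under eq_fun do rewrite big_nil; rewrite big_nil; exact: cvg_cst.
under eq_fun do rewrite big_cons; rewrite big_cons.
by apply: cvgD IH; apply: cvgM (fl i); exact: cvg_cst.
Qed.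

Lemma cvg_norm_le (u : nat -> K) (l B : K) :
  u @ \oo --> l -> (forall N, `|u N| <= B) -> `|l| <= B.
Proof.
move=> ul uB; apply/ler_addgt0Pr => e e0.
move/cvgrPdist_lt: ul => /(_ e e0)[N _ /(_ N (leqnn N)) /= uN].
rewrite -(subrK (u N) l) addrC; apply: le_trans (ler_normD _ _) _.
by apply: lerD; [exact: uB|exact: ltW].
Qed.

End MatrixLimits.

(** * Adjoints, unitaries and diagonal matrices *)

Section Adjoint.
Variable R : realType.
Local Notation C := R[i].

Lemma adjmxE m n (A : 'M[C]_(m, n)) i j : adjmx A i j = Num.conj (A j i).
Proof. by rewrite /adjmx !mxE. Qed.

Lemma adjmxK m n (A : 'M[C]_(m, n)) : adjmx (adjmx A) = A.
Proof. by apply/matrixP => i j; rewrite !adjmxE conjCK. Qed.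

Lemma adjmx_mul m n p (A : 'M[C]_(m, n)) (B : 'M[C]_(n, p)) :
  adjmx (A *m B) = adjmx B *m adjmx A.
Proof. by rewrite /adjmx map_mxM trmx_mul. Qed.

Lemma adjmx1 n : adjmx (1%:M : 'M[C]_n) = 1%:M.
Proof. by rewrite /adjmx map_mx1 trmx1. Qed.

Lemma adjmx_scale m n (a : C) (A : 'M[C]_(m, n)) :
  adjmx (a *: A) = Num.conj a *: adjmx A.
Proof. by rewrite /adjmx map_mxZ linearZ. Qed.

Lemma adjmx_sum m n I (r : seq I) (P : pred I) (F : I -> 'M[C]_(m, n)) :
  adjmx (\sum_(i <- r | P i) F i) = \sum_(i <- r | P i) adjmx (F i).
Proof. by rewrite /adjmx map_mx_sum linear_sum. Qed.

Lemma adjmx_tens m n p q (A : 'M[C]_(m, n)) (B : 'M[C]_(p, q)) :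
  adjmx (A *t B) = adjmx A *t adjmx B.
Proof. by rewrite /adjmx map_mxT trmx_tens. Qed.

Lemma tens1mx1 m n : (1%:M : 'M[C]_m) *t (1%:M : 'M[C]_n) = 1%:M.
Proof.
apply/matrixP => k l; case: (mxtens_indexP k) => i j.
case: (mxtens_indexP l) => i' j'; rewrite tensmxE !mxE.
by rewrite (can_eq (@mxtens_indexK m n)) xpair_eqE -natrM mulnb.
Qed.

Lemma unitary_mx1 n : unitary_mx (1%:M : 'M[C]_n).
Proof. by rewrite /unitary_mx adjmx1 mulmx1. Qed.

Lemma unitary_adjl n (U : 'M[C]_n) : unitary_mx U -> adjmx U *m U = 1%:M.
Proof. exact: mulmx1C. Qed.

Lemma unitary_adj n (U : 'M[C]_n) : unitary_mx U -> unitary_mx (adjmx U).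
Proof. by move=> /unitary_adjl; rewrite /unitary_mx adjmxK. Qed.

Lemma unitary_mul n (U V : 'M[C]_n) :
  unitary_mx U -> unitary_mx V -> unitary_mx (U *m V).
Proof.
move=> uU uV; rewrite /unitary_mx adjmx_mul mulmxA -(mulmxA U).
by rewrite uV mulmx1.
Qed.

Lemma unitary_tens m n (U : 'M[C]_m) (V : 'M[C]_n) :
  unitary_mx U -> unitary_mx V -> unitary_mx (U *t V).
Proof.
by move=> uU uV; rewrite /unitary_mx adjmx_tens tensmx_mul uU uV tens1mx1.
Qed.

(** The diagonal is a function rather than a row, so that products, adjoints and tensor products of
    diagonal matrices become pointwise operations. *)
Definition dgmx n (d : 'I_n -> C) : 'M[C]_n := diag_mx (\row_j d j).

Lemma dgmxE n (d : 'I_n -> C) i j : dgmx d i j = d i *+ (i == j).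
Proof. by rewrite !mxE; case: eqVneq => // ->. Qed.

Lemma dgmx_ext n (d e : 'I_n -> C) : d =1 e -> dgmx d = dgmx e.
Proof. by move=> de; apply/matrixP => i j; rewrite !dgmxE de. Qed.

Lemma mul_dgmx n p (d : 'I_n -> C) (A : 'M[C]_(n, p)) i j :
  (dgmx d *m A) i j = d i * A i j.
Proof. by rewrite mul_diag_mx !mxE. Qed.

Lemma mulmx_dgmx p n (A : 'M[C]_(p, n)) (d : 'I_n -> C) i j :
  (A *m dgmx d) i j = A i j * d j.
Proof. by rewrite mul_mx_diag !mxE. Qed.

Lemma dgmx_mul n (d e : 'I_n -> C) :
  dgmx d *m dgmx e = dgmx (fun i => d i * e i).
Proof. by apply/matrixP => i j; rewrite mul_dgmx !dgmxE mulrnAr. Qed.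

Lemma dgmx1 n : dgmx (fun _ : 'I_n => 1) = 1%:M.
Proof. by apply/matrixP => i j; rewrite dgmxE !mxE. Qed.

Lemma adj_dgmx n (d : 'I_n -> C) : adjmx (dgmx d) = dgmx (fun i => Num.conj (d i)).
Proof.
apply/matrixP => i j; rewrite adjmxE !dgmxE rmorphMn eq_sym.
by case: eqVneq => // ->.
Qed.

Lemma dgmx_tens m n (d : 'I_m -> C) (e : 'I_n -> C) :
  dgmx d *t dgmx e =
  dgmx (fun k => d (mxtens_unindex k).1 * e (mxtens_unindex k).2).
Proof.
apply/matrixP => k l; case: (mxtens_indexP k) => i j.
case: (mxtens_indexP l) => i' j'; rewrite tensmxE !dgmxE mxtens_indexK.
rewrite (can_eq (@mxtens_indexK m n)) xpair_eqE /=.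
by rewrite mulrnAl mulrnAr -mulrnA mulnb andbC.
Qed.

Lemma unitary_cis n (f : 'I_n -> R) : unitary_mx (dgmx (fun j => cis (f j))).
Proof.
rewrite /unitary_mx adj_dgmx dgmx_mul -dgmx1; apply: dgmx_ext => j.
by rewrite conj_cis mulrC cisN.
Qed.

End Adjoint.

(** * Unitary diagonalization and the evolution operator *)

Section Diagonalization.
Variable R : realType.
Local Notation C := R[i].

(** Eigenvectors are the columns of [adjmx U]. The eigenvalues are real by type, in any order and
    with repetitions. *)
Definition diagonalizes n (H U : 'M[C]_n) (d : 'I_n -> R) : Prop :=
  unitary_mx U /\ H = adjmx U *m dgmx (fun j => (d j)%:C) *m U.

Lemma herm_diagonalizes n (H : 'M[C]_n) :
  herm_mx H -> exists U d, diagonalizes H U d.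
Proof.
move=> hH; have adjE m (A : 'M[C]_m) : adjmx A = (A ^t Num.conj)%sesqui.
  by apply/matrixP => i j; rewrite adjmxE !mxE.
have H_herm : H \is hermsymmx.
  by apply/is_hermitianmxP; rewrite expr0 scale1r -adjE hH.
have /orthomx_spectralP HE := hermitian_normalmx H_herm.
have dr := hermitian_spectral_diag_real H_herm.
have uU := spectral_unitarymx H.
exists (spectralmx H), (fun j => complex.Re (spectral_diag H 0 j)); split.
  by rewrite /unitary_mx adjE; apply/unitarymxP.
rewrite (invmx_unitary uU) -adjE in HE; rewrite {1}HE; congr (_ *m _ *m _).
apply/matrixP => i j; rewrite dgmxE mxE RRe_real; last exact: (mxOverP dr).
by case: eqVneq => // ->.
Qed.

Lemma diagonalizes1 n (U : 'M[C]_n) : unitary_mx U ->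
  diagonalizes 1%:M U (fun=> 1).
Proof. by move=> uU; split=> //; rewrite dgmx1 mulmx1 unitary_adjl. Qed.

Lemma diagonalizes_tens m n (P U : 'M[C]_m) p (Q V : 'M[C]_n) q :
  diagonalizes P U p -> diagonalizes Q V q ->
  diagonalizes (P *t Q) (U *t V)
    (fun k => p (mxtens_unindex k).1 * q (mxtens_unindex k).2).
Proof.
move=> [uU ->] [uV ->]; split; first exact: unitary_tens.
rewrite adjmx_tens -!tensmx_mul dgmx_tens; congr (_ *m _ *m _).
by apply: dgmx_ext => k; rewrite rmorphM.
Qed.

(** Powers commute with the conjugation by [U], so each entry of a partial sum is a fixed linear
    combination of the scalar sums [exp_sum N (d j)], and the limit can be taken termwise. *)
Lemma expmx_conj n (A U : 'M[C]_n) (d e : 'I_n -> C) : unitary_mx U ->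
  A = adjmx U *m dgmx d *m U ->
  (forall j, (fun N => exp_sum N (d j)) @ \oo --> (e j : (C : numFieldType))) ->
  expmx A = adjmx U *m dgmx e *m U.
Proof.
move=> uU -> de; rewrite /expmx; apply: (@limn_mx C) => i j.
have powE k : (adjmx U *m dgmx d *m U) ^+ k =
    adjmx U *m dgmx (fun j => d j ^+ k) *m U.
  elim: k => [|k IH].
    by rewrite expr0 dgmx1 mulmx1 unitary_adjl.
  rewrite exprS IH -mulmxE -!mulmxA (mulmxA U) uU mul1mx.
  rewrite (mulmxA (dgmx d)) dgmx_mul; congr (_ *m (_ *m _)).
  by apply: dgmx_ext => l; rewrite exprS.
have entry (f : 'I_n -> C) : (adjmx U *m dgmx f *m U) i j =
    \sum_l adjmx U i l * U l j * f l.
  rewrite -mulmxA mxE; apply: eq_bigr => l _.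
  by rewrite mul_dgmx mulrA mulrAC.
rewrite entry.
under eq_fun => N.
  rewrite (_ : _ i j = \sum_l adjmx U i l * U l j * exp_sum N (d l)).
    over.
  rewrite summxE; under eq_bigr do rewrite mxE powE entry mulr_sumr.
  rewrite exchange_big /=; apply: eq_bigr => l _.
  by rewrite /exp_sum mulr_sumr; apply: eq_bigr => k _; rewrite mulrCA.
exact: (@cvg_lincomb (C : numFieldType)).
Qed.

Lemma evol_diagonalizes n (H U : 'M[C]_n) d t : diagonalizes H U d ->
  evol H t = adjmx U *m dgmx (fun j => cis (- (t * d j))) *m U.
Proof.
move=> [uU HE].
apply: (@expmx_conj _ _ _ (fun j => 'i * (- (t * d j))%:C)) => //.
  rewrite HE scalemxAl scalemxAr; congr (_ *m _ *m _).
  apply/matrixP => i j; rewrite mxE !dgmxE mulrnAr; congr (_ *+ _).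
  by simpc.
by move=> j; exact: cvg_exp_sum.
Qed.

Lemma evol0 n (H : 'M[C]_n) : herm_mx H -> evol H 0 = 1%:M.
Proof.
move=> /herm_diagonalizes[U [d dH]]; rewrite (evol_diagonalizes _ dH).
rewrite (@dgmx_ext _ _ _ (fun=> 1)); last by move=> j; rewrite mul0r oppr0 cis0.
by rewrite dgmx1 mulmx1 unitary_adjl//; case: dH.
Qed.

End Diagonalization.

(** * Extreme eigenvalues and the spread *)

Section Spectrum.
Variable R : realType.
Local Notation C := R[i].

(** [eigenvalue] refers to row vectors. The rows of [U] are eigenvectors in this sense; conversely,
    a nonzero coordinate of [v *m adjmx U] singles out the index [j]. *)
Lemma eigenvalue_diagonalizes n (H U : 'M[C]_n) d a : diagonalizes H U d ->
  eigenvalue H a <-> exists j, a = (d j)%:C.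
Proof.
move=> [uU HE]; split=> [/eigenvalueP[v vH v0]|[j ->]]; last first.
  apply/eigenvalueP; exists (row j U).
    rewrite HE !mulmxA -row_mul uU -row_mul mul1mx.
    apply/rowP => k; rewrite !mxE; under eq_bigr do rewrite !mxE.
    rewrite (bigD1 j)//= eqxx mulr1n big1 ?addr0// => i ij.
    by rewrite eq_sym (negbTE ij) mulr0n mul0r.
  apply/negP => /eqP /(congr1 (mulmx^~ (adjmx U))).
  rewrite -row_mul uU mul0mx => /rowP/(_ j); rewrite !mxE eqxx.
  by move/eqP; rewrite oner_eq0.
pose w := v *m adjmx U.
have w0 : w != 0.
  apply: contra v0 => /eqP /(congr1 (mulmx^~ U)).
  by rewrite -mulmxA unitary_adjl// mulmx1 mul0mx => ->.
have [j wj] : exists j, w 0 j != 0.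
  apply/existsP; apply: contraR w0; rewrite negb_exists => /forallP w0.
  by apply/eqP/rowP => j; rewrite [RHS]mxE; move: (w0 j); rewrite negbK => /eqP.
exists j; have : w *m dgmx (fun j => (d j)%:C) = a *: w.
  rewrite scalemxAl -vH HE -!mulmxA uU mulmx1 !mulmxA.
  by rewrite -[v *m adjmx U]/w.
move=> /rowP/(_ j); rewrite mulmx_dgmx [RHS]mxE mulrC.
by move=> /(mulIf wj).
Qed.

Lemma sup_max_elt (E : set R) x : E x -> (forall y, E y -> y <= x) -> sup E = x.
Proof.
move=> Ex Elex; apply/le_anti/andP; split.
  by apply: ge_sup; [exists x|exact: Elex].
by apply: ub_le_sup => //; exists x; exact: Elex.
Qed.

Lemma inf_min_elt (E : set R) x : E x -> (forall y, E y -> x <= y) -> inf E = x.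
Proof.
move=> Ex xleE; rewrite /inf; have -> : sup (-%R @` E) = - x.
  apply: sup_max_elt; first by exists x.
  by move=> _ [y Ey <-]; rewrite lerN2; exact: xleE.
by rewrite opprK.
Qed.

Lemma herm_extremes n (H : 'M[C]_n) : (0 < n)%N -> herm_mx H ->
  exists U d jx jn, [/\ diagonalizes H U d,
    forall j, d jn <= d j, forall j, d j <= d jx & spread H = d jx - d jn].
Proof.
case: n H => // n H _ /herm_diagonalizes[U [d dH]]; exists U, d.
case: (@arg_maxP _ _ _ ord0 xpredT d) => // jx _ djx.
case: (@arg_minP _ _ _ ord0 xpredT d) => // jn _ djn.
exists jx, jn; split=> // [j|j|]; [exact: djn|exact: djx|].
congr (_ - _); [apply: sup_max_elt|apply: inf_min_elt].
- by exists (d jx)%:C => //; apply/(eigenvalue_diagonalizes _ dH); exists jx.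
- by move=> _ [a /(eigenvalue_diagonalizes _ dH)[j ->] <-]; exact: djx.
- by exists (d jn)%:C => //; apply/(eigenvalue_diagonalizes _ dH); exists jn.
- by move=> _ [a /(eigenvalue_diagonalizes _ dH)[j ->] <-]; exact: djn.
Qed.

(** If the extreme eigenvalues coincide, the diagonal form is scalar, and conjugation by [U] leaves
    it unchanged. *)
Lemma spread_gt0 n (H : 'M[C]_n) : (0 < n)%N -> herm_mx H ->
  (forall a : R, H != a%:C%:M) -> 0 < spread H.
Proof.
move=> n0 /(herm_extremes n0)[U [d [jx [jn [[uU HE] dn dx ->]]]]] Hn.
rewrite subr_gt0 lt_neqAle dn andbT; apply: contra (Hn (d jx)) => /eqP dE.
apply/eqP; rewrite HE (@dgmx_ext _ _ _ (fun=> (d jx)%:C)); last first.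
  by move=> j; congr (_%:C); apply/le_anti; rewrite dx -dE dn.
rewrite (_ : dgmx _ = (d jx)%:C%:M); last first.
  by apply/matrixP => i j; rewrite dgmxE mxE.
by rewrite mul_mx_scalar -scalemxAl unitary_adjl// scalemx1.
Qed.

Lemma herm_real_scale n (a : R) (H : 'M[C]_n) : herm_mx H -> herm_mx (a%:C *: H).
Proof.
by rewrite /herm_mx adjmx_scale => ->; congr (_ *: _); exact: conjc_real.
Qed.

(** By contraposition: a scalar factor can be absorbed into the other one, which leaves a one-sided
    and hence local term; in dimension zero there is only one matrix, and it is local. *)
Lemma nonlocal_spread dA dB (HA : 'M[C]_dA) (HB : 'M[C]_dB) :
  herm_mx HA -> herm_mx HB -> nonlocal_ham (HA *t HB) ->
  [/\ (0 < dA)%N, (0 < dB)%N, 0 < spread HA & 0 < spread HB].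
Proof.
move=> hA hB nl.
have dA0 : (0 < dA)%N.
  case: dA HA hA nl => // HA hA []; exists HA, HB; do !split => //.
  by apply/matrixP => k l; case: (mxtens_indexP k) => -[].
have dB0 : (0 < dB)%N.
  case: dB HB hB nl => // HB hB []; exists HA, HB; do !split => //.
  by apply/matrixP => k l; case: (mxtens_indexP k) => ? -[].
have h0 n : herm_mx (0 : 'M[C]_n) by apply/matrixP => i j; rewrite adjmxE !mxE rmorph0.
split=> //; apply: spread_gt0 => // a; apply: contra_notN nl => /eqP HE.
  exists 0, (a%:C *: HB); do !split => //; first exact: herm_real_scale.
  apply/matrixP => k l; case: (mxtens_indexP k) => i j.
  case: (mxtens_indexP l) => i' j'; rewrite HE [RHS]mxE !tensmxE !mxE mul0r add0r.
  by rewrite mulrCA mulrA mulr_natr.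
exists (a%:C *: HA), 0; do !split => //; first exact: herm_real_scale.
apply/matrixP => k l; case: (mxtens_indexP k) => i j.
case: (mxtens_indexP l) => i' j'; rewrite HE [RHS]mxE !tensmxE !mxE mulr0 addr0.
by rewrite -mulr_natr mulrA [a%:C * _]mulrC.
Qed.

End Spectrum.

(** * Tensor products and the induced channel *)

Section TensorVectors.
Variable R : realType.
Local Notation C := R[i].

(** Product vector. Using [*t] on columns would instead give a matrix with column index type
    ['I_(1 * 1)]. *)
Definition tv m n (a : 'cV[C]_m) (b : 'cV[C]_n) : 'cV[C]_(m * n) :=
  \col_k (a (mxtens_unindex k).1 0 * b (mxtens_unindex k).2 0).

Lemma tvE m n (a : 'cV[C]_m) (b : 'cV[C]_n) i j :
  tv a b (mxtens_index (i, j)) 0 = a i 0 * b j 0.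
Proof. by rewrite mxE mxtens_indexK. Qed.

Lemma cV_tensP m n (a b : 'cV[C]_(m * n)) :
  (forall i j, a (mxtens_index (i, j)) 0 = b (mxtens_index (i, j)) 0) <-> a = b.
Proof.
split=> [ab|-> //]; apply/colP => k; case: (mxtens_indexP k) => i j.
exact: ab.
Qed.

Lemma sum_tens (V : nmodType) m n (F : 'I_(m * n) -> V) :
  \sum_k F k = \sum_i \sum_j F (mxtens_index (i, j)).
Proof.
rewrite pair_big /= (reindex (fun ij : 'I_m * 'I_n => mxtens_index ij)) /=.
  by apply: eq_bigr => -[].
exists (@mxtens_unindex m n) => k _; first exact: mxtens_indexK.
exact: mxtens_unindexK.
Qed.

Lemma tens_tv m n p q (A : 'M[C]_(m, p)) (B : 'M[C]_(n, q)) a b :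
  (A *t B) *m tv a b = tv (A *m a) (B *m b).
Proof.
apply/cV_tensP => i j; rewrite tvE !mxE sum_tens mulr_suml.
apply: eq_bigr => k _; rewrite mulr_sumr; apply: eq_bigr => l _.
by rewrite tensmxE tvE mulrACA.
Qed.

Lemma tvZl m n c (a : 'cV[C]_m) (b : 'cV[C]_n) : tv (c *: a) b = c *: tv a b.
Proof. by apply/cV_tensP => i j; rewrite [RHS]mxE !tvE mxE mulrA. Qed.

Lemma tvZr m n c (a : 'cV[C]_m) (b : 'cV[C]_n) : tv a (c *: b) = c *: tv a b.
Proof. by apply/cV_tensP => i j; rewrite [RHS]mxE !tvE mxE mulrCA. Qed.

Lemma tvDl m n (a a' : 'cV[C]_m) (b : 'cV[C]_n) :
  tv (a + a') b = tv a b + tv a' b.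
Proof. by apply/cV_tensP => i j; rewrite [RHS]mxE !tvE mxE mulrDl. Qed.

Lemma tvDr m n (a : 'cV[C]_m) (b b' : 'cV[C]_n) :
  tv a (b + b') = tv a b + tv a b'.
Proof. by apply/cV_tensP => i j; rewrite [RHS]mxE !tvE mxE mulrDr. Qed.

Lemma mulmx_col m n p (A : 'M[C]_(m, n)) (B : 'M[C]_(n, p)) j :
  A *m col j B = col j (A *m B).
Proof. by rewrite !colE mulmxA. Qed.

Definition evec n (U : 'M[C]_n) j : 'cV[C]_n := col j (adjmx U).

Lemma mul_evec n (U : 'M[C]_n) (f : 'I_n -> C) j : unitary_mx U ->
  adjmx U *m dgmx f *m U *m evec U j = f j *: evec U j.
Proof.
move=> uU; rewrite -mulmxA mulmx_col uU -mulmxA.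
rewrite (_ : _ *m col j 1%:M = f j *: col j 1%:M).
  by rewrite -scalemxAr mulmx_col mulmx1.
by apply/colP => i; rewrite mul_dgmx !mxE; case: eqVneq => [->|]; rewrite ?mulr0.
Qed.

Lemma evec_tens m n (U : 'M[C]_m) (V : 'M[C]_n) i j :
  evec (U *t V) (mxtens_index (i, j)) = tv (evec U i) (evec V j).
Proof.
by apply/cV_tensP => k l; rewrite tvE !mxE !mxtens_indexK rmorphM.
Qed.

Lemma evol_tv m n (P U : 'M[C]_m) p (Q V : 'M[C]_n) q t i j :
  diagonalizes P U p -> diagonalizes Q V q ->
  evol (P *t Q) t *m tv (evec U i) (evec V j) =
  cis (- (t * (p i * q j))) *: tv (evec U i) (evec V j).
Proof.
move=> dP dQ; have dPQ := diagonalizes_tens dP dQ.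
rewrite (evol_diagonalizes _ dPQ) -evec_tens mul_evec ?mxtens_indexK//.
by case: dPQ.
Qed.

Lemma evec_dot n (U : 'M[C]_n) i j : unitary_mx U ->
  adjmx (evec U i) *m evec U j = ((i == j)%:R)%:M.
Proof.
move=> uU; apply/matrixP => k l; rewrite !ord1 {k l}.
transitivity ((U *m adjmx U) i j); last by rewrite uU !mxE mulr1n.
by rewrite !mxE; apply: eq_bigr => k _; rewrite !mxE conjCK.
Qed.

(** The products of eigenvectors are the columns of the adjoint of the unitary [U *t V], hence a
    basis. *)
Lemma evec_ext m n p (U : 'M[C]_m) (V : 'M[C]_n) (A B : 'M[C]_(p, m * n)) :
  unitary_mx U -> unitary_mx V ->
  (forall i j, A *m tv (evec U i) (evec V j) = B *m tv (evec U i) (evec V j)) ->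
  A = B.
Proof.
move=> uU uV AB; have uW := unitary_tens uU uV.
suff: A *m adjmx (U *t V) = B *m adjmx (U *t V).
  move=> /(congr1 (mulmx^~ (U *t V))).
  by rewrite -!mulmxA unitary_adjl// !mulmx1.
apply/matrixP => k l; case: (mxtens_indexP l) => i j.
have := AB i j; rewrite -evec_tens !mulmx_col => /colP/(_ k).
by rewrite [LHS]mxE [RHS]mxE.
Qed.

End TensorVectors.

(** * The embedded Hamiltonian and the channel induced on the target *)

Section Channel.
Variable R : realType.
Local Notation C := R[i].

(** The embedded Hamiltonian is again a product across the cut between Alice and Bob, so every
    statement on [evol (P *t Q)] applies to it. *)
Lemma embedH_tens dA dB dA' dB' na nb (HA : 'M[C]_dA) (HB : 'M[C]_dB) :
  @embedH R dA dB dA' dB' na nb (HA *t HB) =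
  (1%:M *t (HA *t 1%:M)) *t (1%:M *t (HB *t 1%:M)).
Proof.
apply/matrixP => k l; rewrite mxE.
case: (mxtens_indexP k) => x y; case: (mxtens_indexP l) => x' y'.
case: (mxtens_indexP x) => xt xX; case: (mxtens_indexP x') => xt' xX'.
case: (mxtens_indexP y) => yt yY; case: (mxtens_indexP y') => yt' yY'.
case: (mxtens_indexP xX) => xA xa; case: (mxtens_indexP xX') => xA' xa'.
case: (mxtens_indexP yY) => yB yb; case: (mxtens_indexP yY') => yB' yb'.
rewrite !mxtens_indexK !tensmxE !mxE.
by case: eqVneq => _; case: eqVneq => _; case: eqVneq => _; case: eqVneq => _ /=;
  rewrite ?(mulr0, mul0r, mulr1, mul1r).
Qed.

Definition ket0 n : 'cV[C]_n := \col_i (val i == 0%N)%:R.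

Definition attach_mx d n : 'M[C]_(d * n, d) :=
  \matrix_(k, i) (((mxtens_unindex k).1 == i)%:R * ket0 n (mxtens_unindex k).2 0).

Lemma attach_mxE d n (a : 'cV[C]_d) : attach_mx d n *m a = tv a (ket0 n).
Proof.
apply/cV_tensP => i j; rewrite tvE mxE (bigD1 i)//= big1.
  by rewrite mxE mxtens_indexK eqxx mul1r addr0 mulrC.
by move=> k ki; rewrite mxE mxtens_indexK /= eq_sym (negbTE ki) !mul0r.
Qed.

Variables (dA dB dA' dB' na nb : nat).
Local Notation nX := (dA * na)%N.
Local Notation nY := (dB * nb)%N.
Local Notation N := ((dA' * nX) * (dB' * nY))%N.
Local Notation J := (attach_mx dA' nX *t attach_mx dB' nY).
Local Notation gidx := (@gidx dA dB dA' dB' na nb).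

Lemma attach2E i u v j : J (gidx i u v) j =
  (i == j)%:R * (ket0 nX u 0 * ket0 nY v 0).
Proof.
case: (mxtens_indexP i) => x y; case: (mxtens_indexP j) => x' y'.
rewrite /gidx !mxtens_indexK tensmxE !mxE !mxtens_indexK /=.
rewrite mulrACA; congr (_ * _).
by rewrite (can_eq (@mxtens_indexK _ _)) xpair_eqE -natrM mulnb.
Qed.

Lemma attach2_conj (M : 'M[C]_(dA' * dB')) i u v j u' v' :
  (J *m M *m adjmx J) (gidx i u v) (gidx j u' v') =
  M i j * (ket0 nX u 0 * ket0 nY v 0 * (ket0 nX u' 0 * ket0 nY v' 0)).
Proof.
rewrite mxE (bigD1 j)//= [X in _ + X]big1 ?addr0; last first.
  move=> k kj; rewrite adjmxE attach2E eq_sym (negbTE kj) mul0r.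
  by rewrite rmorph0 mulr0.
rewrite mxE (bigD1 i)//= [X in (_ + X) * _]big1 ?addr0; last first.
  by move=> k ki; rewrite attach2E eq_sym (negbTE ki) !mul0r.
rewrite adjmxE !attach2E !eqxx !mul1r rmorphM !mxE !rmorph_nat.
ring.
Qed.

(** The initial global state is [J *m rho *m adjmx J], so only [W *m J] matters; the double sum is
    the partial trace over [X] and [Y]. *)
Lemma induced_channelE (W : 'M[C]_N) rho i j :
  induced_channel W rho i j = \sum_u \sum_v
    (W *m J *m rho *m adjmx (W *m J)) (gidx i u v) (gidx j u v).
Proof.
rewrite mxE; apply: eq_bigr => u _; apply: eq_bigr => v _.
rewrite adjmx_mul !mulmxA.
rewrite (_ : W *m J *m rho *m adjmx J = W *m (J *m rho *m adjmx J)); last first.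
  by rewrite !mulmxA.
congr ((_ *m _ *m _) _ _); apply/matrixP => k l.
have gidxP (k' : 'I_N) : exists i u v, k' = gidx i u v.
  case: (mxtens_indexP k') => x y; case: (mxtens_indexP x) => xt xX.
  case: (mxtens_indexP y) => yt yY.
  by exists (mxtens_index (xt, yt)), xX, yY; rewrite /gidx mxtens_indexK.
have [i1 [u1 [v1 ->]]] := gidxP k; have [i2 [u2 [v2 ->]]] := gidxP l.
rewrite attach2_conj mxE /gidx.
case: (mxtens_indexP i1) => x1 y1; case: (mxtens_indexP i2) => x2 y2.
rewrite !mxtens_indexK /= !mxE.
by case: eqVneq => _; case: eqVneq => _; case: eqVneq => _; case: eqVneq => _ /=;
  rewrite ?(mulr0, mul0r, mulr1, mul1r).
Qed.

Lemma ket0_sum n : (0 < n)%N -> \sum_u ket0 n u 0 = 1.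
Proof.
case: n => // n _; rewrite big_ord_recl mxE /= big1 ?addr0// => i _.
by rewrite mxE.
Qed.

(** The hypothesis says that [W] returns [X] and [Y] to [ket0]. Tracing them out then contributes
    the factor 1, which requires both dimensions to be positive. *)
Lemma induced_channel_exact (W : 'M[C]_N) V rho : (0 < nX)%N -> (0 < nY)%N ->
  W *m J = J *m V -> induced_channel W rho = unitary_channel V rho.
Proof.
move=> nX0 nY0 WJ; apply/matrixP => i j; rewrite induced_channelE WJ.
rewrite adjmx_mul !mulmxA -[J *m V *m rho]mulmxA -[J *m (V *m rho) *m _]mulmxA.
under eq_bigr do under eq_bigr do rewrite attach2_conj.
rewrite -/(unitary_channel V rho).
transitivity (unitary_channel V rho i j *
    ((\sum_u ket0 nX u 0) * (\sum_v ket0 nY v 0))).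
  rewrite mulr_suml mulr_sumr; apply: eq_bigr => u _.
  rewrite !mulr_sumr; apply: eq_bigr => v _; congr (_ * _).
  by rewrite !mxE -!natrM !mulnb andbb.
by rewrite !ket0_sum// !mulr1.
Qed.

End Channel.

(** * The upper bound *)

Section ProductBound.
Variable R : realType.
Local Notation C := R[i].

Definition nsq n (a : 'cV[C]_n) : C := \sum_i `|a i 0| ^+ 2.

Lemma nsqE n (a : 'cV[C]_n) : nsq a = (adjmx a *m a) 0 0.
Proof.
rewrite mxE; apply: eq_bigr => i _.
by rewrite adjmxE normCKC.
Qed.

Lemma nsq_ge0 n (a : 'cV[C]_n) : 0 <= nsq a.
Proof. by apply: sumr_ge0 => i _; rewrite exprn_ge0. Qed.

Lemma nsq_unitary n (U : 'M[C]_n) a : unitary_mx U -> nsq (U *m a) = nsq a.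
Proof.
by move=> uU; rewrite !nsqE adjmx_mul mulmxA -(mulmxA _ _ U) unitary_adjl// mulmx1.
Qed.

Lemma nsq_dgmx n (f : 'I_n -> C) a : (forall j, `|f j| <= 1) ->
  nsq (dgmx f *m a) <= nsq a.
Proof.
move=> f1; apply: ler_sum => j _; rewrite mul_dgmx normrM exprMn.
by rewrite ler_piMl ?exprn_ge0// exprn_ile1.
Qed.

(* Dual to the trace norm of bipartite states: [F] is seen as a bilinear form. *)
Definition bilin_le m n (F : 'rV[C]_(m * n)) (r : R) : Prop :=
  forall a b, nsq a <= 1 -> nsq b <= 1 -> `|(F *m tv a b) 0 0| <= r%:C.

Lemma bilin_le_local m n (F : 'rV[C]_(m * n)) r U V :
  unitary_mx U -> unitary_mx V -> bilin_le F r -> bilin_le (F *m (U *t V)) r.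
Proof.
move=> uU uV Fr a b a1 b1; rewrite -mulmxA tens_tv.
by apply: Fr; rewrite nsq_unitary.
Qed.

Lemma exp_sum_le N (x : R) : 0 <= x ->
  \sum_(k < N) (k`!%:R)^-1 * x ^+ k <= expR x.
Proof.
move=> x0; have -> : \sum_(k < N) (k`!%:R)^-1 * x ^+ k = series (exp_coeff x) N.
  rewrite /series /= big_mkord; apply: eq_bigr => k _.
  by rewrite /exp_coeff /= mulrC.
apply: nondecreasing_cvgn_le.
  apply: nondecreasing_series => k _ _.
  by rewrite /exp_coeff /= divr_ge0 ?exprn_ge0.
exact: is_cvg_series_exp_coeff.
Qed.

(** In the exponential series the [i]-th power of the diagonal [x *t y] sends [tv a b] to a product
    vector whose factors are no longer than [a] and [b]. That term is therefore at most
    [r * s ^ i / i!], and these bounds sum to at most [r * expR s]. *)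
Lemma bilin_le_ising m n (F : 'rV[C]_(m * n)) (r s : R)
    (x : 'I_m -> R) (y : 'I_n -> R) : 0 <= s -> 0 <= r ->
  (forall j, `|x j| <= 1) -> (forall k, `|y k| <= 1) ->
  bilin_le F r ->
  bilin_le (F *m dgmx (fun k =>
    cis (- (s * (x (mxtens_unindex k).1 * y (mxtens_unindex k).2)))))
    (r * expR s).
Proof.
move=> s0 r0 x1 y1 Fr a b a1 b1.
pose th k := - (s * (x (mxtens_unindex k).1 * y (mxtens_unindex k).2)).
pose c k := F 0 k * tv a b k 0.
have gl : (fun N => \sum_k c k * exp_sum N ('i * (th k)%:C)) @ \oo -->
    (\sum_k c k * cis (th k) : (C : numFieldType)).
  by apply: (@cvg_lincomb (C : numFieldType)) => k; exact: cvg_exp_sum.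
have -> : (F *m dgmx (fun k => cis (th k)) *m tv a b) 0 0 =
    \sum_k c k * cis (th k).
  rewrite mxE; apply: eq_bigr => k _.
  by rewrite mulmx_dgmx mulrAC.
have gle N : `|\sum_k c k * exp_sum N ('i * (th k)%:C)| <= (r * expR s)%:C.
  pose X i := dgmx (fun j => (x j ^+ i)%:C); pose Y i := dgmx (fun j => (y j ^+ i)%:C).
  have -> : \sum_k c k * exp_sum N ('i * (th k)%:C) =
      \sum_(i < N) (i`!%:R)^-1 * (- ('i * s%:C)) ^+ i *
        (F *m tv (X i *m a) (Y i *m b)) 0 0.
    under eq_bigr do rewrite mulr_sumr.
    rewrite exchange_big /=; apply: eq_bigr => i _.
    rewrite mxE mulr_sumr; apply: eq_bigr => k _.
    rewrite /c /th; case: (mxtens_indexP k) => j l; rewrite mxtens_indexK /=.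
    rewrite !tvE !mul_dgmx !rmorphXn /=.
    have -> : 'i * (- (s * (x j * y l)))%:C = - ('i * s%:C) * (x j)%:C * (y l)%:C :> C.
      by rewrite rmorphN !rmorphM /=; ring.
    rewrite !exprMn; ring.
  apply: le_trans (ler_norm_sum _ _ _) _.
  apply: le_trans (_ : (\sum_(i < N) (i`!%:R)^-1 * s ^+ i * r)%:C <= _).
    rewrite rmorph_sum /=; apply: ler_sum => i _.
    rewrite !normrM rmorphM /= normfV normr_nat normrX normrN normrM.
    rewrite (_ : `|'i| = 1 :> C); last first.
      by rewrite normc_def /= expr0n expr1n add0r sqrtr1.
    rewrite mul1r (_ : `|s%:C| = s%:C :> C); last by rewrite ger0_norm// lecR.
    rewrite rmorphM rmorphXn fmorphV rmorph_nat; apply: ler_wpM2l.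
      by rewrite mulr_ge0 ?invr_ge0 ?ler0n// exprn_ge0// lecR.
    have nrm (z : R) : `|z| <= 1 -> `|(z ^+ i)%:C : C| <= 1.
      move=> z1; rewrite normc_def /= expr0n addr0 sqrtr_sqr.
      by rewrite (lecR _ 1) normrX exprn_ile1.
    by apply: Fr; [apply: le_trans a1|apply: le_trans b1];
      apply: nsq_dgmx => j; exact: nrm.
  by rewrite lecR -mulr_suml mulrC ler_wpM2l// exp_sum_le.
exact: (@cvg_norm_le (C : numFieldType)) gl gle.
Qed.

(** With centred eigenvalues, [p q = be p + al g y + h g x y]. The first two terms give local
    diagonal unitaries, which do not change the bound; the last one is handled by [bilin_le_ising]
    with time [s * (h * g)]. *)
Lemma bilin_le_evol m n (F : 'rV[C]_(m * n)) (r s al be h g : R)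
    (P U : 'M[C]_m) p (Q V : 'M[C]_n) q :
  0 <= s -> 0 <= r -> 0 < h -> 0 < g ->
  diagonalizes P U p -> diagonalizes Q V q ->
  (forall j, `|p j - al| <= h) -> (forall k, `|q k - be| <= g) ->
  bilin_le F r -> bilin_le (F *m evol (P *t Q) s) (r * expR (s * (h * g))).
Proof.
move=> s0 r0 h0 g0 dP dQ ph qg Fr.
have [uU _] := dP; have [uV _] := dQ.
rewrite (evol_diagonalizes _ (diagonalizes_tens dP dQ)) adjmx_tens.
pose x j := (p j - al) / h; pose y k := (q k - be) / g.
have pE j : p j = al + h * x j by rewrite /x; field; exact: lt0r_neq0.
have qE k : q k = be + g * y k by rewrite /y; field; exact: lt0r_neq0.
rewrite (_ : dgmx _ =
  (dgmx (fun j => cis (- (s * (be * p j)))) *t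
   dgmx (fun k => cis (- (s * (al * (g * y k)))))) *m
  dgmx (fun k => cis (- (s * (h * g) *
    (x (mxtens_unindex k).1 * y (mxtens_unindex k).2))))); last first.
  rewrite dgmx_tens dgmx_mul; apply: dgmx_ext => k; rewrite -!cisD qE pE.
  by congr cis; ring.
rewrite !mulmxA; apply: bilin_le_local => //.
apply: bilin_le_ising => //; first by rewrite mulr_ge0// mulr_ge0// ltW.
- by move=> j; rewrite /x normrM normfV (gtr0_norm h0) ler_pdivrMr// mul1r.
- by move=> k; rewrite /y normrM normfV (gtr0_norm g0) ler_pdivrMr// mul1r.
apply: bilin_le_local; [exact: unitary_cis|exact: unitary_cis|].
by apply: bilin_le_local => //; exact: unitary_adj.
Qed.

End ProductBound.

(** * Detecting the trace norm on the target systems alone *)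

Section Witness.
Variable R : realType.
Local Notation C := R[i].

Lemma cauchy_schwarz (I : finType) (x y : I -> C) :
  `|\sum_i x i * y i| ^+ 2 <= (\sum_i `|x i| ^+ 2) * (\sum_i `|y i| ^+ 2).
Proof.
set A := \sum_i `|x i| ^+ 2; set B := \sum_i `|y i| ^+ 2.
pose P := \sum_i `|x i| * `|y i|.
have P0 : 0 <= P by apply: sumr_ge0 => i _; exact: mulr_ge0.
apply: le_trans (_ : P ^+ 2 <= _).
  rewrite ler_pXn2r ?nnegrE//; apply: le_trans (ler_norm_sum _ _ _) _.
  by apply: ler_sum => i _; rewrite normrM.
rewrite -subr_ge0 -(pmulr_rge0 _ (ltr0n _ 2)).
(* Lagrange's identity, doubled so that the sum runs over all ordered pairs. *)
suff -> : 2 * (A * B - P ^+ 2) =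
    \sum_i \sum_j (`|x i| * `|y j| - `|x j| * `|y i|) ^+ 2.
  apply: sumr_ge0 => i _; apply: sumr_ge0 => j _; apply: real_exprn_even_ge0 => //.
have -> : 2 * (A * B - P ^+ 2) = A * B + B * A - 2 * (P * P) by ring.
rewrite /A /B /P !mulr_suml mulr_sumr -big_split -sumrB /=.
apply: eq_bigr => i _; rewrite !mulr_sumr -big_split -sumrB /=.
by apply: eq_bigr => j _; ring.
Qed.

Lemma ge0_realC (z : C) : 0 <= z -> exists2 s : R, 0 <= s & z = s%:C.
Proof.
by move=> z0; exists (complex.Re z); rewrite -?lecR RRe_real// ger0_real.
Qed.

(* [F] below is the row maximising the left-hand side; read as a bilinear
   form it is the composition of three contractions. *)
Lemma witness_bound d1 d2 n1 n2 (w : 'I_d1 -> 'I_d2 -> C)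
    (psi : 'cV[C]_((d1 * n1) * (d2 * n2))) (r : R) : 0 <= r ->
  (forall c : 'cV[C]_d2, \sum_x `|\sum_y w x y * c y 0| ^+ 2 <= nsq c) ->
  (forall F s, 0 <= s -> bilin_le F s -> `|(F *m psi) 0 0| <= (s * r)%:C) ->
  \sum_u \sum_v `|\sum_x \sum_y
    w x y * psi (mxtens_index (mxtens_index (x, u), mxtens_index (y, v))) 0| ^+ 2
  <= (r ^+ 2)%:C.
Proof.
move=> r0 wle psile.
pose eta u v := \sum_x \sum_y
  w x y * psi (mxtens_index (mxtens_index (x, u), mxtens_index (y, v))) 0.
pose S := \sum_u \sum_v `|eta u v| ^+ 2; rewrite -/S.
have S0 : 0 <= S by do 2!(apply: sumr_ge0 => ? _); exact: exprn_ge0.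
have [s s0 SE] := ge0_realC S0.
pose F : 'rV[C]_((d1 * n1) * (d2 * n2)) := \row_k
  let: (a, b) := mxtens_unindex k in
  let: (x, u) := mxtens_unindex a in let: (y, v) := mxtens_unindex b in
  Num.conj (eta u v) * w x y.
have FE z : (F *m z) 0 0 = \sum_u \sum_v Num.conj (eta u v) * \sum_x \sum_y
    w x y * z (mxtens_index (mxtens_index (x, u), mxtens_index (y, v))) 0.
  rewrite mxE sum_tens sum_tens exchange_big /=; apply: eq_bigr => u _.
  transitivity (\sum_x \sum_v \sum_y F 0 (mxtens_index (mxtens_index (x, u),
    mxtens_index (y, v))) * z (mxtens_index (mxtens_index (x, u),
    mxtens_index (y, v))) 0).
    by apply: eq_bigr => x _; rewrite sum_tens exchange_big.
  rewrite exchange_big /=; apply: eq_bigr => v _; rewrite mulr_sumr.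
  apply: eq_bigr => x _; rewrite mulr_sumr; apply: eq_bigr => y _.
  by rewrite mxE !mxtens_indexK mulrA.
have Fle : bilin_le F (Num.sqrt s).
  move=> a b a1 b1; rewrite -(@ler_pXn2r _ 2) ?nnegrE ?normr_ge0//; last first.
    by rewrite lecR sqrtr_ge0.
  rewrite (_ : (Num.sqrt s)%:C ^+ 2 = S); last first.
    by rewrite SE -[in RHS](sqr_sqrtr s0) rmorphXn.
  rewrite FE.
  pose c v : 'cV[C]_d2 := \col_y b (mxtens_index (y, v)) 0.
  pose k u v := \sum_x a (mxtens_index (x, u)) 0 * \sum_y w x y * c v y 0.
  have kE u v : \sum_x \sum_y w x y *
      tv a b (mxtens_index (mxtens_index (x, u), mxtens_index (y, v))) 0 = k u v.
    apply: eq_bigr => x _; rewrite mulr_sumr; apply: eq_bigr => y _.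
    by rewrite tvE mxE mulrCA.
  under eq_bigr do under eq_bigr do rewrite kE.
  (* Cauchy-Schwarz over the pair [(u, v)] splits off [S]; a second one, over [x], together with
     [wle] bounds the remaining factor by [nsq a * nsq b]. *)
  rewrite pair_big /=; apply: le_trans (cauchy_schwarz _ _) _.
  rewrite (_ : \sum_i _ = S); last first.
    by rewrite /S pair_big; apply: eq_bigr => uv _; rewrite norm_conjC.
  apply: ler_piMr => //.
  rewrite -(pair_big xpredT xpredT (fun u v => `|k u v| ^+ 2)) /=.
  apply: le_trans (_ : nsq a * nsq b <= _); last first.
    by rewrite -[leRHS]mulr1; apply: ler_pM => //; exact: nsq_ge0.
  have -> : nsq a = \sum_u \sum_x `|a (mxtens_index (x, u)) 0| ^+ 2.
    by rewrite /nsq sum_tens exchange_big.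
  have -> : nsq b = \sum_v nsq (c v).
    rewrite /nsq sum_tens exchange_big /=; apply: eq_bigr => v _.
    by apply: eq_bigr => y _; rewrite mxE.
  rewrite mulr_suml; apply: ler_sum => u _; rewrite mulr_sumr.
  apply: ler_sum => v _; apply: le_trans (cauchy_schwarz _ _) _.
  by apply: ler_wpM2l (wle _); apply: sumr_ge0 => x _; exact: exprn_ge0.
(* The value of [F] on [psi] is [S] itself, so [s <= Num.sqrt s * r], and one factor [Num.sqrt s]
   cancels. *)
have := psile F _ (sqrtr_ge0 _) Fle; rewrite FE.
rewrite (_ : \sum_u _ = S); last first.
  apply: eq_bigr => u _; apply: eq_bigr => v _.
  by rewrite -/(eta u v) normCKC.
rewrite SE ger0_norm ?lecR// => sle.
have : Num.sqrt s <= r.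
  have [s_gt0|] := ltP 0 (Num.sqrt s); last by move=> /le_trans; apply.
  by rewrite -(ler_pM2l s_gt0) -expr2 sqr_sqrtr.
by move=> sr; rewrite -(sqr_sqrtr s0) ler_pXn2r ?nnegrE ?sqrtr_ge0.
Qed.

Lemma nsq_evec2 n (U : 'M[C]_n) (a b : C) i j : unitary_mx U -> i != j ->
  nsq (a *: evec U i + b *: evec U j) = `|a| ^+ 2 + `|b| ^+ 2.
Proof.
move=> uU ij; rewrite nsqE.
have -> : adjmx (a *: evec U i + b *: evec U j) =
    Num.conj a *: adjmx (evec U i) + Num.conj b *: adjmx (evec U j).
  by apply/matrixP => k l; rewrite !(adjmxE, mxE) rmorphD !rmorphM.
rewrite mulmxDl !mulmxDr -!scalemxAl -!scalemxAr !evec_dot// !eqxx.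
rewrite (negbTE ij) eq_sym (negbTE ij) !mxE !mulr1n !normCK !mulr0n.
ring.
Qed.

Lemma bessel2 n (U : 'M[C]_n) (c : 'cV[C]_n) i j : unitary_mx U -> i != j ->
  `|(adjmx (evec U i) *m c) 0 0| ^+ 2 + `|(adjmx (evec U j) *m c) 0 0| ^+ 2
  <= nsq c.
Proof.
move=> uU ij; rewrite -(nsq_unitary c uU).
have E k : (U *m c) k 0 = (adjmx (evec U k) *m c) 0 0.
  by rewrite !mxE; apply: eq_bigr => l _; rewrite !mxE conjCK.
rewrite -!E /nsq (bigD1 i)//= (bigD1 j)//=; last by rewrite eq_sym.
by rewrite addrA lerDl; apply: sumr_ge0 => k _; exact: exprn_ge0.
Qed.

End Witness.

(** * Growth along a protocol, and quadratic forms of the output state *)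

Section ProtocolBound.
Variable R : realType.
Local Notation C := R[i].

(** The row [F] meets the last step first, hence the induction from the end of [ss]. Each step costs
    a factor [expR (s.1 * (h * g))]: tensoring with identities only repeats the eigenvalues of [HA]
    and [HB]. *)
Lemma prot_bilin_le dA dB dA' dB' na nb (HA UA : 'M[C]_dA) (HB UB : 'M[C]_dB)
    p q al be h g U0 ss : 0 < h -> 0 < g ->
  diagonalizes HA UA p -> diagonalizes HB UB q ->
  (forall j, `|p j - al| <= h) -> (forall k, `|q k - be| <= g) ->
  @prot_valid R dA dB dA' dB' na nb U0 ss ->
  forall F r, 0 <= r -> bilin_le F r ->
  bilin_le (F *m prot_op (HA *t HB) U0 ss) (r * expR (prot_time ss * (h * g))).
Proof.
move=> h0 g0 dHA dHB ph qg [uU0 [uV0 vss]].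
have dPA := diagonalizes_tens (diagonalizes1 (unitary_mx1 R dA'))
  (diagonalizes_tens dHA (diagonalizes1 (unitary_mx1 R na))).
have dPB := diagonalizes_tens (diagonalizes1 (unitary_mx1 R dB'))
  (diagonalizes_tens dHB (diagonalizes1 (unitary_mx1 R nb))).
elim/last_ind: ss vss => [_|ss s IH vss] F r r0 Fr.
  rewrite /prot_time big_nil mul0r expR0 mulr1.
  exact: bilin_le_local.
have [s0 [uU uV]] : 0 <= s.1 /\ unitary_mx s.2.1 /\ unitary_mx s.2.2.
  by apply: vss; rewrite mem_rcons mem_head.
rewrite /prot_op foldl_rcons -/(prot_op _ _ _) mulmxA.
rewrite (_ : r * expR _ =
    r * expR (s.1 * (h * g)) * expR (prot_time ss * (h * g))); last first.
  by rewrite /prot_time big_rcons /= mulrDl expRD; ring.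
apply: IH.
- by move=> s' s'ss; apply: vss; rewrite mem_rcons inE s'ss orbT.
- by rewrite mulr_ge0// expR_ge0.
rewrite /step_op mulmxA embedH_tens.
apply: bilin_le_evol dPA dPB _ _ _ => //.
- by move=> j; rewrite mul1r mulr1.
- by move=> k; rewrite mul1r mulr1.
- exact: bilin_le_local.
Qed.

Lemma mulmx_delta_expand m n k l (A : 'M[C]_(m, n)) (B : 'M[C]_(k, l))
    (M : 'M[C]_(n, k)) i j :
  (A *m M *m B) i j = \sum_a \sum_b M a b * (A *m delta_mx a b *m B) i j.
Proof.
rewrite {1}[M]matrix_sum_delta mulmx_sumr mulmx_suml summxE.
apply: eq_bigr => a _; rewrite mulmx_sumr mulmx_suml summxE.
by apply: eq_bigr => b _; rewrite -scalemxAr -scalemxAl mxE.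
Qed.

Lemma unitary_channel_delta n (V rho : 'M[C]_n) i j :
  unitary_channel V rho i j =
  \sum_a \sum_b rho a b * unitary_channel V (delta_mx a b) i j.
Proof. exact: mulmx_delta_expand. Qed.

Lemma induced_channel_delta dA dB dA' dB' na nb W rho i j :
  @induced_channel R dA dB dA' dB' na nb W rho i j =
  \sum_a \sum_b rho a b *
    @induced_channel R dA dB dA' dB' na nb W (delta_mx a b) i j.
Proof.
rewrite induced_channelE.
under [RHS]eq_bigr do under eq_bigr do
  (rewrite induced_channelE mulr_sumr; under eq_bigr do rewrite mulr_sumr).
set WJ := W *m _.
transitivity (\sum_u \sum_v \sum_a \sum_b rho a b *
    (WJ *m delta_mx a b *m adjmx WJ) (gidx i u v) (gidx j u v)).
  by apply: eq_bigr => u _; apply: eq_bigr => v _; exact: mulmx_delta_expand.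
rewrite pair_big /= [RHS]pair_big /=.
under [RHS]eq_bigr do rewrite pair_big /=.
under eq_bigr do rewrite pair_big /=.
by rewrite exchange_big.
Qed.

(** Expectation of the rank-one observable on the entrywise conjugate of [w]; on a pure state [phi]
    it is the squared modulus of the bilinear pairing of [w] with [phi]. *)
Definition quad_form n (w : 'cV[C]_n) (M : 'M[C]_n) : C :=
  \sum_i \sum_j w i 0 * M i j * Num.conj (w j 0).

(** [chan_close] controls matrix units only; linearity extends it to [rho], with a constant that
    depends on [w] and [rho] but not on the channels. *)
Lemma quad_form_close n (Phi Psi : 'M[C]_n -> 'M[C]_n) (w : 'cV[C]_n) rho :
  (forall i j, Phi rho i j =
     \sum_a \sum_b rho a b * Phi (delta_mx a b) i j) ->
  (forall i j, Psi rho i j =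
     \sum_a \sum_b rho a b * Psi (delta_mx a b) i j) ->
  forall eps : R, chan_close Phi Psi eps ->
  `|quad_form w (Phi rho) - quad_form w (Psi rho)| <=
  (\sum_i \sum_j `|w i 0| * `|w j 0| * \sum_a \sum_b `|rho a b|) * eps%:C.
Proof.
move=> PhiE PsiE eps close; rewrite -sumrB mulr_suml.
apply: le_trans (ler_norm_sum _ _ _) _; apply: ler_sum => i _.
rewrite -sumrB mulr_suml.
apply: le_trans (ler_norm_sum _ _ _) _; apply: ler_sum => j _.
rewrite -mulrBl -mulrBr !normrM norm_conjC -[leRHS]mulrA mulrAC.
apply: ler_wpM2l; first by rewrite mulr_ge0.
rewrite PhiE PsiE -sumrB mulr_suml.
apply: le_trans (ler_norm_sum _ _ _) _; apply: ler_sum => a _.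
rewrite -sumrB mulr_suml.
apply: le_trans (ler_norm_sum _ _ _) _; apply: ler_sum => b _.
by rewrite -mulrBr normrM ler_wpM2l// close.
Qed.

Lemma quad_form_rank1 n (w phi : 'cV[C]_n) :
  quad_form w (phi *m adjmx phi) = `|\sum_i w i 0 * phi i 0| ^+ 2.
Proof.
rewrite normCK rmorph_sum mulr_suml; apply: eq_bigr => i _.
rewrite mulr_sumr; apply: eq_bigr => j _.
by rewrite rmorphM mxE big_ord1 adjmxE; ring.
Qed.

Lemma quad_form_induced dA dB dA' dB' na nb W (w : 'I_dA' -> 'I_dB' -> C) a b :
  quad_form (\col_i w (mxtens_unindex i).1 (mxtens_unindex i).2)
    (@induced_channel R dA dB dA' dB' na nb W (tv a b *m adjmx (tv a b))) =
  \sum_u \sum_v `|\sum_x \sum_y w x y *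
    (W *m tv (tv a (ket0 R (dA * na))) (tv b (ket0 R (dB * nb))))
      (mxtens_index (mxtens_index (x, u), mxtens_index (y, v))) 0| ^+ 2.
Proof.
rewrite -!attach_mxE -tens_tv mulmxA.
set psi := _ *m tv a b.
transitivity (\sum_u \sum_v `|\sum_i w (mxtens_unindex i).1 (mxtens_unindex i).2 *
    psi (gidx i u v) 0| ^+ 2); last first.
  apply: eq_bigr => u _; apply: eq_bigr => v _; congr (`|_| ^+ 2).
  rewrite sum_tens; apply: eq_bigr => x _; apply: eq_bigr => y _.
  by rewrite /gidx mxtens_indexK.
rewrite /quad_form; under eq_bigr do under eq_bigr do
  rewrite induced_channelE mulr_sumr mulr_suml.
under eq_bigr do rewrite exchange_big.
rewrite exchange_big /=; apply: eq_bigr => u _.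
under eq_bigr do under eq_bigr do rewrite mulr_sumr mulr_suml.
under eq_bigr do rewrite exchange_big.
rewrite exchange_big /=; apply: eq_bigr => v _.
rewrite normCK rmorph_sum mulr_suml; apply: eq_bigr => i _.
rewrite mulr_sumr; apply: eq_bigr => j _.
rewrite mulmxA -mulmxA -adjmx_mul -/psi !mxE big_ord1 !mxE rmorphM.
ring.
Qed.

End ProtocolBound.

(** * A product state that the target evolution entangles at the full rate *)

Section UpperBound.
Variable R : realType.
Local Notation C := R[i].

Let conjD (x y : C) : Num.conj (x + y) = Num.conj x + Num.conj y.
Proof. exact: rmorphD. Qed.

Let conjM (x y : C) : Num.conj (x * y) = Num.conj x * Num.conj y.
Proof. exact: rmorphM. Qed.

(** [ga] and [de] are the conjugated coefficients of [|++> - i |-->] in the product eigenbasis: [ga]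
    on equal indices, [de] on opposite ones. *)
Let ga : C := (1 / 2 : R) +i* (1 / 2 : R).
Let de : C := (1 / 2 : R) +i* - (1 / 2 : R).

Let conj_ga : Num.conj ga = de. Proof. by []. Qed.

Let conj_de : Num.conj de = ga.
Proof. by rewrite -conj_ga conjCK. Qed.

Let ga_de : ga * de = 2^-1.
Proof.
rewrite (_ : 2^-1 = (2^-1 : R)%:C); last by rewrite fmorphV rmorph_nat.
by rewrite /ga /de; simpc; congr (_ +i* _); field.
Qed.

Let ga2_de2 : ga ^+ 2 + de ^+ 2 = 0.
Proof.
rewrite !expr2 /ga /de; simpc; apply/eqP; rewrite eq_complex /=.
by apply/andP; split; apply/eqP; field.
Qed.

Let ga_de_cis x : ga * cis (- x) + de * cis x = (cos x + sin x)%:C :> C.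
Proof.
rewrite /cis /ga /de cosN sinN; simpc; apply/eqP; rewrite eq_complex /=.
by apply/andP; split; apply/eqP; field.
Qed.

(** The symmetric 2 by 2 matrix with diagonal [ga] and off-diagonal [de] is unitary, because
    [2 * (ga * de) = 1] and [ga ^+ 2 + de ^+ 2 = 0]. *)
Let parallelogram (s1 s2 : C) :
  `|ga * s1 + de * s2| ^+ 2 + `|de * s1 + ga * s2| ^+ 2 = `|s1| ^+ 2 + `|s2| ^+ 2.
Proof.
rewrite !normCK !conjD !conjM conj_ga conj_de.
transitivity (2 * (ga * de) * (s1 * Num.conj s1 + s2 * Num.conj s2) +
  (ga ^+ 2 + de ^+ 2) * (s1 * Num.conj s2 + s2 * Num.conj s1)); first by ring.
by rewrite ga2_de2 ga_de mul0r addr0 mulfV ?mul1r// pnatr_eq0.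
Qed.

Let tv_comb m n (e1 e2 : 'cV[C]_m) (f1 f2 : 'cV[C]_n) x1 x2 y1 y2 :
  tv (x1 *: e1 + x2 *: e2) (y1 *: f1 + y2 *: f2) =
  (x1 * y1) *: tv e1 f1 + (x1 * y2) *: tv e1 f2 +
  ((x2 * y1) *: tv e2 f1 + (x2 * y2) *: tv e2 f2).
Proof. by rewrite tvDl !tvDr !tvZl !tvZr !scalerA. Qed.

Let mulmx_comb n (M : 'rV[C]_n) (v1 v2 v3 v4 : 'cV[C]_n) x1 x2 x3 x4 :
  (M *m (x1 *: v1 + x2 *: v2 + (x3 *: v3 + x4 *: v4))) 0 0 =
  x1 * (M *m v1) 0 0 + x2 * (M *m v2) 0 0 +
  (x3 * (M *m v3) 0 0 + x4 * (M *m v4) 0 0) :> C.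
Proof.
rewrite !mulmxDr -!scalemxAr.
have mxD (x y : 'M[C]_1) : (x + y) 0 0 = x 0 0 + y 0 0 by rewrite mxE.
have mxZ (z : C) (x : 'M[C]_1) : (z *: x) 0 0 = z * x 0 0 by rewrite mxE.
by rewrite !mxD !mxZ.
Qed.

(* The phases put into [a] and [b] cancel the local part of [P *t Q], so that
   the evolved state is [cos th |++> - i sin th |-->] up to a global phase; it
   is paired with [|++> - i |-->], which is a matrix of operator norm one. *)
Lemma witness_target m n (P U : 'M[C]_m) p (Q V : 'M[C]_n) q
    (i1 i2 : 'I_m) (k1 k2 : 'I_n) t :
  diagonalizes P U p -> diagonalizes Q V q -> i1 != i2 -> k1 != k2 ->
  let th := t * ((p i1 - p i2) / 2 * ((q k1 - q k2) / 2)) in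
  exists (a : 'cV[C]_m) (b : 'cV[C]_n) (w : 'I_m -> 'I_n -> C),
  [/\ nsq a <= 1, nsq b <= 1,
    forall c : 'cV[C]_n, \sum_x `|\sum_y w x y * c y 0| ^+ 2 <= nsq c &
    `|\sum_i w (mxtens_unindex i).1 (mxtens_unindex i).2 *
       (evol (P *t Q) t *m tv a b) i 0| ^+ 2 = ((cos th + sin th) ^+ 2)%:C].
Proof.
move=> dP dQ i12 k12 th; have [uU _] := dP; have [uV _] := dQ.
pose al := (p i1 + p i2) / 2; pose h := (p i1 - p i2) / 2.
pose be := (q k1 + q k2) / 2; pose g := (q k1 - q k2) / 2.
pose e1 := evec U i1; pose e2 := evec U i2.
pose f1 := evec V k1; pose f2 := evec V k2.
pose c : C := (Num.sqrt (1 / 2))%:C.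
have c0 : 0 <= c by rewrite lecR sqrtr_ge0.
have cc : c * c = 2^-1.
  rewrite -rmorphM -expr2 sqr_sqrtr ?divr_ge0//= div1r.
  by rewrite fmorphV rmorph_nat.
pose fa : C := cis (t * (be * h)); pose fa' : C := cis (- (t * (be * h))).
pose fb : C := cis (t * (al * g)); pose fb' : C := cis (- (t * (al * g))).
pose a := (c * fa) *: e1 + (c * fa') *: e2.
pose b := (c * fb) *: f1 + (c * fb') *: f2.
pose w x y : C :=
  ga * (Num.conj (e1 x 0) * Num.conj (f1 y 0) + Num.conj (e2 x 0) * Num.conj (f2 y 0)) +
  de * (Num.conj (e1 x 0) * Num.conj (f2 y 0) + Num.conj (e2 x 0) * Num.conj (f1 y 0)).
have unit_half (r s : R) k (W : 'M[C]_k) j j' : unitary_mx W -> j != j' ->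
    nsq ((c * cis r) *: evec W j + (c * cis s) *: evec W j') <= 1.
  move=> uW jj'; rewrite nsq_evec2// !normrM !norm_cis !mulr1 ger0_norm//.
  by rewrite !expr2 cc -div1r -splitr.
exists a, b, w; split; [exact: unit_half|exact: unit_half| |].
  (* As a matrix, [w] takes the coordinates of [z] along [f1] and [f2], mixes them by the unitary of
     [parallelogram], and writes the result on the conjugates of [e1] and [e2]. Bessel's inequality
     concludes. *)
  move=> z; pose s1 := (adjmx f1 *m z) 0 0; pose s2 := (adjmx f2 *m z) 0 0.
  pose A := ga * s1 + de * s2; pose B := de * s1 + ga * s2.
  have wz x : \sum_y w x y * z y 0 = Num.conj (e1 x 0) * A + Num.conj (e2 x 0) * B.
    rewrite /A /B /s1 /s2 ![(_ *m _) _ _]mxE !mulr_sumr -!big_split /= !mulr_sumr -big_split /=.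
    by apply: eq_bigr => y _; rewrite !adjmxE /w; ring.
  rewrite (_ : \sum_x _ = nsq (Num.conj A *: e1 + Num.conj B *: e2)); last first.
    apply: eq_bigr => x _; rewrite wz -norm_conjC.
    rewrite [RHS](_ : _ = `|Num.conj A * e1 x 0 + Num.conj B * e2 x 0| ^+ 2);
      last by rewrite !mxE.
    by rewrite conjD !conjM !conjCK ![Num.conj A * _]mulrC ![Num.conj B * _]mulrC.
  rewrite nsq_evec2// !norm_conjC /A /B parallelogram.
  exact: bessel2.
pose wr : 'rV[C]_(m * n) := \row_i w (mxtens_unindex i).1 (mxtens_unindex i).2.
have wrE (z : 'cV[C]_(m * n)) : \sum_i w (mxtens_unindex i).1 (mxtens_unindex i).2 * z i 0 =
    (wr *m z) 0 0.
  by rewrite mxE; apply: eq_bigr => i _; rewrite mxE.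
have wr_tv (a' : 'cV[C]_m) (b' : 'cV[C]_n) : (wr *m tv a' b') 0 0 =
    ga * ((adjmx e1 *m a') 0 0 * (adjmx f1 *m b') 0 0 +
          (adjmx e2 *m a') 0 0 * (adjmx f2 *m b') 0 0) +
    de * ((adjmx e1 *m a') 0 0 * (adjmx f2 *m b') 0 0 +
          (adjmx e2 *m a') 0 0 * (adjmx f1 *m b') 0 0).
  rewrite -wrE sum_tens.
  under eq_bigr do under eq_bigr do rewrite mxtens_indexK tvE.
  rewrite ![(_ *m _) _ _]mxE !mulr_suml -!big_split /= !mulr_sumr -big_split /=.
  apply: eq_bigr => x _; rewrite !mulr_sumr -!big_split /= !mulr_sumr -big_split /=.
  by apply: eq_bigr => y _; rewrite !adjmxE /w /=; ring.
have dot (k : nat) (W : 'M[C]_k) j j' : unitary_mx W ->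
    (adjmx (evec W j) *m evec W j') 0 0 = (j == j')%:R.
  by move=> uW; rewrite evec_dot// !mxE mulr1n.
have i21 : (i2 == i1) = false by rewrite eq_sym (negbTE i12).
have k21 : (k2 == k1) = false by rewrite eq_sym (negbTE k12).
have E11 : (wr *m tv e1 f1) 0 0 = ga.
  by rewrite wr_tv !dot// !eqxx i21 k21 !(mulr0, mul0r, mulr1, addr0).
have E22 : (wr *m tv e2 f2) 0 0 = ga.
  by rewrite wr_tv !dot// !eqxx (negbTE i12) (negbTE k12) !(mulr0, mul0r, mulr1, addr0, add0r).
have E12 : (wr *m tv e1 f2) 0 0 = de.
  by rewrite wr_tv !dot// !eqxx i21 (negbTE k12) !(mulr0, mul0r, mulr1, addr0, add0r).
have E21 : (wr *m tv e2 f1) 0 0 = de.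
  by rewrite wr_tv !dot// !eqxx k21 (negbTE i12) !(mulr0, mul0r, mulr1, addr0, add0r).
rewrite wrE mulmxA /a /b tv_comb mulmx_comb.
have evolE i k : (wr *m evol (P *t Q) t *m tv (evec U i) (evec V k)) 0 0 =
    cis (- (t * (p i * q k))) * (wr *m tv (evec U i) (evec V k)) 0 0.
  by rewrite -mulmxA (evol_tv _ _ _ dP dQ) -scalemxAr [LHS]mxE.
rewrite !evolE E11 E12 E21 E22.
have pE1 : p i1 = al + h by rewrite /al /h; field.
have pE2 : p i2 = al - h by rewrite /al /h; field.
have qE1 : q k1 = be + g by rewrite /be /g; field.
have qE2 : q k2 = be - g by rewrite /be /g; field.
have thE : th = t * (h * g) by [].
(* In [(al ± h) (be ± g)] the terms [be h] and [al g] are cancelled by the prepared phases; what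
   remains is the common phase from [al be] and a sign times [th]. *)
have z11 : fa * (fb * cis (- (t * (p i1 * q k1)))) = cis (- (t * (al * be))) * cis (- th).
  by rewrite /fa /fb -!cisD pE1 qE1 thE; congr cis; ring.
have z12 : fa * (fb' * cis (- (t * (p i1 * q k2)))) = cis (- (t * (al * be))) * cis th.
  by rewrite /fa /fb' -!cisD pE1 qE2 thE; congr cis; ring.
have z21 : fa' * (fb * cis (- (t * (p i2 * q k1)))) = cis (- (t * (al * be))) * cis th.
  by rewrite /fa' /fb -!cisD pE2 qE1 thE; congr cis; ring.
have z22 : fa' * (fb' * cis (- (t * (p i2 * q k2)))) = cis (- (t * (al * be))) * cis (- th).
  by rewrite /fa' /fb' -!cisD pE2 qE2 thE; congr cis; ring.
set S := (X in `|X|).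
have -> : S = cis (- (t * (al * be))) * (cos th + sin th)%:C.
  transitivity (c * c * (ga * (fa * (fb * cis (- (t * (p i1 * q k1)))) +
       fa' * (fb' * cis (- (t * (p i2 * q k2))))) +
     de * (fa * (fb' * cis (- (t * (p i1 * q k2)))) +
       fa' * (fb * cis (- (t * (p i2 * q k1))))))).
    by rewrite /S; ring.
  rewrite z11 z12 z21 z22 -ga_de_cis cc.
  set zz := cis (- (t * _)); set z1 := cis (- th); set z2 := cis th.
  transitivity (2^-1 * 2 * (zz * (ga * z1 + de * z2))); first by ring.
  by rewrite mulVf ?mul1r// pnatr_eq0.
rewrite normrM norm_cis mul1r rmorphXn /=.
by rewrite real_normK//; apply/complex_realP; exists (cos th + sin th).
Qed.

End UpperBound.

(** * From the witness to the bound on the rate *)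

Section RateUpper.
Variable R : realType.
Local Notation C := R[i].

(** The left side is [1 + sin (2 t K)], of slope [2 K] at zero, and the right side has slope [2 c].
    If [c < K], a small explicit time violates the hypothesis. *)
Lemma small_time (c K : R) : 0 < K -> 0 <= c ->
  (forall t, 0 <= t -> (cos (t * K) + sin (t * K)) ^+ 2 <= expR (2 * (t * c))) ->
  K <= c.
Proof.
move=> K0 c0 H; rewrite leNgt; apply/negP => cK.
(* [m] is the midpoint of [rho] and 1. It will serve as a lower bound for the slope of the sine that
   still exceeds [rho]. *)
pose rho := c / K; pose m := (1 + rho) / 2.
have rho0 : 0 <= rho by rewrite divr_ge0// ltW.
have rho1 : rho < 1 by rewrite ltr_pdivrMr// mul1r.
have m1 : m < 1 by rewrite /m; lra.
have : \forall y \near (0 : R), m < cos y.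
  by apply: (cvgr_gt _ (@continuous_cos R 0)); rewrite cos0.
move=> /nbhs_ballP[d /= d0 dcos].
(* Halving makes [x] strictly smaller than both [d], so that the cosine exceeds [m] up to [x], and
   [m - rho], which absorbs the second-order term below. *)
pose x := Num.min d (m - rho) / 2.
have md0 : 0 < Num.min d (m - rho) by rewrite lt_min d0 /m; lra.
have x0 : 0 < x by rewrite divr_gt0.
have xd : x < d.
  have : Num.min d (m - rho) <= d by rewrite ge_min lexx.
  by rewrite /x; lra.
have xm : x < m - rho.
  have : Num.min d (m - rho) <= m - rho by rewrite ge_min lexx orbT.
  by rewrite /x; lra.
have [xi] := @MVT R (@sin R) (@cos R) 0 x x0 (fun y _ => is_derive_sin y)
  (continuous_subspaceT (@continuous_sin R)).
rewrite in_itv /= sin0 !subr0 => /andP[xi0 xix] sinE.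
have cosm : m < cos xi.
  by apply: dcos; rewrite /ball /= sub0r normrN gtr0_norm// (lt_trans xix).
have t0 : 0 <= x / (2 * K) by rewrite divr_ge0 ?ltW// mulr_gt0.
have := H _ t0.
have -> : x / (2 * K) * K = x / 2 by field; exact: lt0r_neq0.
have -> : 2 * (x / (2 * K) * c) = rho * x.
  by rewrite /rho; field; exact: lt0r_neq0.
have -> : (cos (x / 2) + sin (x / 2)) ^+ 2 = 1 + sin x.
  rewrite {3}(splitr x) sinD sqrrD addrAC cos2Dsin2; congr (_ + _); ring.
apply/negP; rewrite -ltNge sinE.
(* This yields [expR (rho * x) <= 1 / (1 - rho * x)], which is then shown to lie below
   [1 + m * x]. *)
have e1 : 1 - rho * x <= expR (- (rho * x)) by exact: expR_ge1Dx.
have rx : rho * x < x by rewrite gtr_pMl.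
have x1 : x < 1 by lra.
have e2 : 0 < 1 - rho * x by lra.
have e3 : expR (rho * x) * (1 - rho * x) <= 1.
  by rewrite -[leRHS](expRxMexpNx_1 (rho * x)) ler_pM2l// expR_gt0.
rewrite -(ltr_pM2r e2); apply: (le_lt_trans e3).
have : 1 < (1 + m * x) * (1 - rho * x).
  have -> : (1 + m * x) * (1 - rho * x) = 1 + x * (m - rho - m * (rho * x)) by ring.
  rewrite ltrDl mulr_gt0//.
  have m0 : 0 < m by rewrite /m; lra.
  have : m * (rho * x) <= rho * x by apply: ler_piMl (mulr_ge0 rho0 (ltW x0)) (ltW m1).
  lra.
move=> /lt_le_trans; apply; rewrite ler_pM2r// lerD2l ler_pM2r//.
exact: ltW.
Qed.

Lemma nsq_tv m n (a : 'cV[C]_m) (b : 'cV[C]_n) : nsq (tv a b) = nsq a * nsq b.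
Proof.
rewrite /nsq sum_tens mulr_suml; apply: eq_bigr => i _.
by rewrite mulr_sumr; apply: eq_bigr => j _; rewrite tvE normrM exprMn.
Qed.

Lemma nsq_ket0 n : nsq (ket0 R n) <= 1.
Proof.
case: n => [|n]; first by rewrite /nsq big_ord0.
rewrite /nsq big_ord_recl big1 ?addr0 => [|i _]; rewrite !mxE.
  by rewrite normr1 expr1n.
by rewrite normr0 expr0n.
Qed.

Lemma nsq_attach d n (a : 'cV[C]_d) : nsq a <= 1 -> nsq (tv a (ket0 R n)) <= 1.
Proof.
by move=> a1; rewrite nsq_tv -[leRHS]mulr1 ler_pM ?nsq_ge0 ?nsq_ket0.
Qed.

Lemma mid_radius n (p : 'I_n -> R) jx jn : (forall j, p jn <= p j) ->
  (forall j, p j <= p jx) ->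
  forall j, `|p j - (p jx + p jn) / 2| <= (p jx - p jn) / 2.
Proof.
move=> pn px j; have := pn j; have := px j.
by rewrite ler_norml => *; apply/andP; split; lra.
Qed.

Lemma rate_upper dA dB dA' dB' (HA : 'M[C]_dA) (HB : 'M[C]_dB)
    (HA' : 'M[C]_dA') (HB' : 'M[C]_dB') gamma :
  herm_mx HA -> herm_mx HB -> herm_mx HA' -> herm_mx HB' ->
  nonlocal_ham (HA *t HB) -> nonlocal_ham (HA' *t HB') ->
  achievable_rate (HA *t HB) (HA' *t HB') gamma ->
  gamma <= Kprod HA HB / Kprod HA' HB'.
Proof.
move=> hA hB hA' hB' nl nl' [gamma0 sim].
have [dA0 dB0 sA sB] := nonlocal_spread hA hB nl.
have [dA'0 dB'0 sA' sB'] := nonlocal_spread hA' hB' nl'.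
have KE (s s' : R) : s * s' / 4 = (s / 2) * (s' / 2) by field.
have K'0 : 0 < Kprod HA' HB' by rewrite /Kprod divr_gt0// mulr_gt0.
have K0 : 0 < Kprod HA HB by rewrite /Kprod divr_gt0// mulr_gt0.
suff : Kprod HA' HB' <= Kprod HA HB / gamma.
  by rewrite (ler_pdivlMr _ _ gamma0) (ler_pdivlMr _ _ K'0) mulrC.
apply: small_time => //; first by rewrite divr_ge0// ltW.
have [U [p [jx [jn [dU pn px sE]]]]] := herm_extremes dA0 hA.
have [V [q [kx [kn [dV qn qx sE']]]]] := herm_extremes dB0 hB.
have [U' [p' [jx' [jn' [dU' _ _ tE]]]]] := herm_extremes dA'0 hA'.
have [V' [q' [kx' [kn' [dV' _ _ tE']]]]] := herm_extremes dB'0 hB'.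
have jj' : jx' != jn' by apply: contraTneq sA' => jE; rewrite tE jE subrr ltxx.
have kk' : kx' != kn' by apply: contraTneq sB' => kE; rewrite tE' kE subrr ltxx.
have h0 : 0 < (p jx - p jn) / 2 by rewrite -sE divr_gt0.
have g0 : 0 < (q kx - q kn) / 2 by rewrite -sE' divr_gt0.
have hgE : (p jx - p jn) / 2 * ((q kx - q kn) / 2) = Kprod HA HB.
  by rewrite /Kprod KE sE sE'.
move=> t t0.
have [a [b [w [a1 b1 wle wE]]]] := witness_target t dU' dV' jj' kk'.
rewrite -KE -tE -tE' -/(Kprod HA' HB') in wE.
pose wv : 'cV[C]_(dA' * dB') := \col_i w (mxtens_unindex i).1 (mxtens_unindex i).2.
pose phi := tv a b.
pose c := \sum_i \sum_j `|wv i 0| * `|wv j 0| *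
  \sum_k \sum_l `|(phi *m adjmx phi) k l|.
have [c' c'0 cE] : exists2 c' : R, 0 <= c' & c = c'%:C.
  apply: ge0_realC; do 2!(apply: sumr_ge0 => ? _).
  by rewrite !mulr_ge0//; do 2!(apply: sumr_ge0 => ? _).
(* The simulation is only approximate, so the inequality is proved up to any [e]. The [+ 1] in the
   accuracy keeps the denominator positive when [c'] vanishes. *)
apply/ler_addgt0Pr => e e0.
have eps0 : 0 < e / (c' + 1) by rewrite divr_gt0// ltr_wpDl.
have [na [nb [U0 [ss [vss [Tle close]]]]]] := sim t t0 _ eps0.
pose T := prot_time ss.
have := quad_form_close wv (induced_channel_delta _ (phi *m adjmx phi))
  (unitary_channel_delta _ (phi *m adjmx phi)) close.
rewrite -/c cE.
set X := quad_form wv (induced_channel _ _); set Y := quad_form wv _.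
(* Bound on the simulated value: it involves the total time but neither [na] nor [nb]. *)
have Xle : X <= (expR (T * Kprod HA HB) ^+ 2)%:C.
  rewrite /X quad_form_induced; apply: witness_bound wle _; first exact: expR_ge0.
  move=> F s s0 Fs; rewrite mulmxA -hgE.
  apply: (prot_bilin_le h0 g0 dU dV (mid_radius pn px) (mid_radius qn qx) vss) => //.
    exact: nsq_attach.
  exact: nsq_attach.
have X0 : 0 <= X.
  by rewrite /X quad_form_induced; do 2!(apply: sumr_ge0 => ? _); exact: exprn_ge0.
have YE : Y = ((cos (t * Kprod HA' HB') + sin (t * Kprod HA' HB')) ^+ 2)%:C.
  rewrite -wE /Y /unitary_channel mulmxA -mulmxA -adjmx_mul quad_form_rank1.
  by congr (`|_| ^+ 2); apply: eq_bigr => i _; rewrite mxE.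
move=> XY; rewrite -lecR -YE.
have YX : Y <= X + `|X - Y|.
  rewrite -lerBlDl distrC; apply: real_ler_norm; apply: realB.
    by rewrite YE; apply/complex_realP; eexists.
  exact: ger0_real.
apply: (le_trans YX); rewrite rmorphD; apply: lerD; last first.
  apply: (le_trans XY); rewrite -rmorphM lecR mulrA ler_pdivrMr ?ltr_wpDl//.
  by rewrite mulrC ler_pM2l// lerDl.
apply: (le_trans Xle); rewrite lecR -expRM_natl ler_expR ler_pM2l//.
by rewrite [leRHS]mulrA [leRHS]mulrAC ler_pM2r.
Qed.

End RateUpper.

(** * The exact simulation *)

Section Simulation.
Variable R : realType.
Local Notation C := R[i].

(* Product measure: the coordinates [u j] are independent, and [u j] selects
   [c1] with the probability that makes the mean [r j]. *)
Lemma sign_average n (c0 c1 : R) (r : 'I_n -> R) : c0 < c1 ->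
  (forall j, c0 <= r j) -> (forall j, r j <= c1) ->
  exists L : {ffun 'I_n -> bool} -> R, [/\ forall u, 0 <= L u, \sum_u L u = 1 &
    forall j, \sum_u L u * (if u j then c1 else c0) = r j].
Proof.
move=> c01 r0 r1; have c10 : 0 < c1 - c0 by rewrite subr_gt0.
pose la j := (r j - c0) / (c1 - c0).
pose F j (b : bool) := if b then la j else 1 - la j.
have la0 j : 0 <= la j by rewrite divr_ge0 ?subr_ge0// ltW.
have la1 j : la j <= 1 by rewrite ler_pdivrMr// mul1r lerB.
have F1 j : \sum_b F j b = 1 by rewrite big_bool /F /= addrC subrK.
exists (fun u => \prod_j F j (u j)); split.
- by move=> u; apply: prodr_ge0 => j _; rewrite /F; case: ifP => _ //; rewrite subr_ge0.
- by rewrite -(bigA_distr_bigA F) big1.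
(* Inserting the value into the factor at [j0] lets the expectation factor over coordinates; all
   factors except that one equal 1. *)
move=> j0; pose G j b := F j b * (if j == j0 then if b then c1 else c0 else 1).
under eq_bigr => u _.
  rewrite (_ : _ * _ = \prod_j G j (u j)); last first.
    rewrite big_split /=; congr (_ * _).
    rewrite (bigD1 j0)//= eqxx big1 ?mulr1// => j jj0.
    by rewrite (negbTE jj0).
  over.
rewrite -(bigA_distr_bigA G) (bigD1 j0)//= [X in _ * X]big1 => [|j jj0]; last first.
  transitivity (\sum_b F j b) => //; apply: eq_bigr => b _.
  by rewrite /G (negbTE jj0) mulr1.
rewrite mulr1 big_bool /G /F /= eqxx /la.
by field; exact: lt0r_neq0.
Qed.

(** Conditional operation: [X j] acts on the second factor when the first is in the eigenvector
    [evec U j]. *)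
Definition controlled d n (U : 'M[C]_d) (X : 'I_d -> 'M[C]_n) : 'M[C]_(d * n) :=
  \sum_j (evec U j *m adjmx (evec U j)) *t X j.

Lemma controlled_tv d n (U : 'M[C]_d) (X : 'I_d -> 'M[C]_n) j z : unitary_mx U ->
  controlled U X *m tv (evec U j) z = tv (evec U j) (X j *m z).
Proof.
move=> uU; rewrite /controlled mulmx_suml (bigD1 j)//= big1 ?addr0.
  by rewrite tens_tv -mulmxA evec_dot// eqxx mulmx1.
move=> k kj; rewrite tens_tv -mulmxA evec_dot// (negbTE kj).
by apply/cV_tensP => x y; rewrite tvE -scalemx1 scale0r mulmx0 !mxE mul0r.
Qed.

Lemma adj_controlled d n (U : 'M[C]_d) (X : 'I_d -> 'M[C]_n) :
  adjmx (controlled U X) = controlled U (fun j => adjmx (X j)).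
Proof.
rewrite /controlled adjmx_sum; apply: eq_bigr => j _.
by rewrite adjmx_tens adjmx_mul adjmxK.
Qed.

Lemma unitary_controlled d n (U : 'M[C]_d) (X : 'I_d -> 'M[C]_n) : unitary_mx U ->
  (forall j, unitary_mx (X j)) -> unitary_mx (controlled U X).
Proof.
move=> uU uX; rewrite /unitary_mx adj_controlled.
apply: (@evec_ext _ _ _ _ U 1%:M) => //; first exact: unitary_mx1.
move=> i j; rewrite mul1mx -mulmxA !controlled_tv//.
by rewrite mulmxA uX mul1mx.
Qed.

(** Swap the basis vectors 0 and [j], then apply [adjmx U], whose column [j] is [evec U j]. *)
Lemma unitary_ket0 n (U : 'M[C]_n) j : unitary_mx U ->
  exists2 X : 'M[C]_n, unitary_mx X & X *m ket0 R n = evec U j.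
Proof.
move=> uU; case: n U j uU => [U []//|n U j uU].
exists (adjmx U *m tperm_mx ord0 j).
  apply: unitary_mul; first exact: unitary_adj.
  rewrite /unitary_mx (_ : adjmx _ = (tperm_mx ord0 j)^T); last first.
    by apply/matrixP => k l; rewrite adjmxE !mxE rmorph_nat.
  by rewrite tr_perm_mx tpermV -perm_mxM tperm2 perm_mx1.
rewrite -mulmxA (_ : _ *m ket0 R n.+1 = delta_mx j 0); last first.
  rewrite (_ : ket0 R n.+1 = delta_mx ord0 0); last first.
    by apply/colP => i; rewrite !mxE eqxx andbT.
  rewrite -row_permE; apply/colP => i; rewrite !mxE !andbT.
  by rewrite -[X in _ == X](tpermR ord0 j) (inj_eq perm_inj).
by rewrite /evec colE.
Qed.

End Simulation.

(** * The protocol attaining the rate *)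

Section RateLower.
Variable R : realType.
Local Notation C := R[i].

Lemma herm_tens m n (P : 'M[C]_m) (Q : 'M[C]_n) :
  herm_mx P -> herm_mx Q -> herm_mx (P *t Q).
Proof. by rewrite /herm_mx adjmx_tens => -> ->. Qed.

Lemma herm1 n : herm_mx (1%:M : 'M[C]_n).
Proof. exact: adjmx1. Qed.

(** [step_op] evolves before applying its unitaries, so a step of duration 0 is used to prepare the
    eigenvectors of [HA] and [HB]; the next step evolves for [tau] and undoes the preparation. Only
    a phase is left on [Psi]. *)
Lemma step_eigen dA dB dA' dB' (HA UA : 'M[C]_dA) (HB UB : 'M[C]_dB) p q
    (U' : 'M[C]_dA') (V' : 'M[C]_dB') X Y j k ja jb tau :
  herm_mx HA -> herm_mx HB ->
  diagonalizes HA UA p -> diagonalizes HB UB q -> unitary_mx U' -> unitary_mx V' ->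
  unitary_mx (X j) -> unitary_mx (Y k) ->
  X j *m ket0 R (dA * 1) = evec (UA *t (1%:M : 'M[C]_1)) (mxtens_index (ja, ord0)) ->
  Y k *m ket0 R (dB * 1) = evec (UB *t (1%:M : 'M[C]_1)) (mxtens_index (jb, ord0)) ->
  let Psi := tv (tv (evec U' j) (ket0 R (dA * 1)))
                (tv (evec V' k) (ket0 R (dB * 1))) in
  let CX := controlled U' X in let CY := controlled V' Y in
  @step_op R dA dB dA' dB' 1 1 (HA *t HB) (tau, (adjmx CX, adjmx CY)) *m
    (step_op (HA *t HB) (0, (CX, CY)) *m Psi) =
  cis (- (tau * (p ja * q jb))) *: Psi.
Proof.
move=> hA hB dHA dHB uU' uV' uX uY XE YE Psi CX CY.
rewrite /step_op /= embedH_tens evol0; last first.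
  by do !apply: herm_tens => //; exact: herm1.
rewrite mulmx1 tens_tv /CX /CY !controlled_tv// XE YE.
have dPA := diagonalizes_tens (diagonalizes1 uU')
  (diagonalizes_tens dHA (diagonalizes1 (unitary_mx1 R 1))).
have dPB := diagonalizes_tens (diagonalizes1 uV')
  (diagonalizes_tens dHB (diagonalizes1 (unitary_mx1 R 1))).
rewrite -!(evec_tens U') -!(evec_tens V') -mulmxA (evol_tv _ _ _ dPA dPB).
rewrite !mxtens_indexK /= !mulr1 !mul1r (evec_tens U') (evec_tens V').
rewrite -scalemxAr tens_tv !adj_controlled (controlled_tv _ _ _ uU').
rewrite (controlled_tv _ _ _ uV') -XE -YE.
rewrite (mulmxA (adjmx (X j))) (mulmxA (adjmx (Y k))).
by rewrite (unitary_adjl uX) (unitary_adjl uY) !mul1mx.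
Qed.

Lemma step0 dA dB dA' dB' na nb (HA : 'M[C]_dA) (HB : 'M[C]_dB) X Y :
  herm_mx HA -> herm_mx HB ->
  @step_op R dA dB dA' dB' na nb (HA *t HB) (0, (X, Y)) = X *t Y.
Proof.
move=> hA hB; rewrite /step_op /= embedH_tens evol0 ?mulmx1//.
by do !apply: herm_tens => //; exact: herm1.
Qed.

(** Every block has the same eigenvector [Psi], so the phases simply add up, whatever the order of
    the blocks. *)
Lemma foldl_eigen (I S : Type) n (st : S -> 'M[C]_n) (blk : I -> S * S)
    (Psi : 'cV[C]_n) (ph : I -> R) l s W c :
  (forall i, st (blk i).2 *m (st (blk i).1 *m Psi) = cis (- ph i) *: Psi) ->
  W *m Psi = c *: Psi ->
  foldl (fun W s => st s *m W) W
    (flatten [seq [:: (blk i).1; (blk i).2] | i <- l] ++ [:: s]) *m Psi =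
  (cis (- \sum_(i <- l) ph i) * c) *: (st s *m Psi).
Proof.
move=> stE; elim: l W c => [|i l IH] W c WE /=.
  by rewrite big_nil oppr0 cis0 mul1r -mulmxA WE scalemxAr.
rewrite (IH _ (cis (- ph i) * c)).
  by rewrite big_cons opprD cisD; congr (_ *: _); ring.
by rewrite -!mulmxA WE -!scalemxAr stE scalerA mulrC.
Qed.

Lemma rate_lower dA dB dA' dB' (HA : 'M[C]_dA) (HB : 'M[C]_dB)
    (HA' : 'M[C]_dA') (HB' : 'M[C]_dB') :
  herm_mx HA -> herm_mx HB -> herm_mx HA' -> herm_mx HB' ->
  nonlocal_ham (HA *t HB) -> nonlocal_ham (HA' *t HB') ->
  achievable_rate (HA *t HB) (HA' *t HB') (Kprod HA HB / Kprod HA' HB').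
Proof.
move=> hA hB hA' hB' nl nl'.
have [dA0 dB0 sA sB] := nonlocal_spread hA hB nl.
have [dA'0 dB'0 sA' sB'] := nonlocal_spread hA' hB' nl'.
have K'0 : 0 < Kprod HA' HB' by rewrite /Kprod divr_gt0// mulr_gt0.
have K0 : 0 < Kprod HA HB by rewrite /Kprod divr_gt0// mulr_gt0.
split=> [|t t0 eps eps0]; first exact: divr_gt0.
have [U [p [jx [jn [dU pn px sE]]]]] := herm_extremes dA0 hA.
have [V [q [kx [kn [dV qn qx tE]]]]] := herm_extremes dB0 hB.
have [U' [p' [jx' [jn' [dU' pn' px' sE']]]]] := herm_extremes dA'0 hA'.
have [V' [q' [kx' [kn' [dV' qn' qx' tE']]]]] := herm_extremes dB'0 hB'.
have [uU _] := dU; have [uV _] := dV; have [uU' _] := dU'; have [uV' _] := dV'.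
have uU1 := unitary_tens uU (unitary_mx1 R 1).
have uV1 := unitary_tens uV (unitary_mx1 R 1).
(* [A] and [a0] define the increasing affine map from the spectral range of [HA'] onto that of [HA],
   and [B], [b0] the one for Bob. Its values are thus averages of the two extreme eigenvalues. *)
pose A := spread HA / spread HA'; pose B := spread HB / spread HB'.
have A0 : 0 < A by exact: divr_gt0.
have B0 : 0 < B by exact: divr_gt0.
pose a0 := p jn - A * p' jn'; pose b0 := q kn - B * q' kn'.
have interp m (f : 'I_m -> R) s s' jn0 jx0 lo hi : 0 < s' -> 0 < s ->
    s' = f jx0 - f jn0 -> s = hi - lo ->
    (forall j, f jn0 <= f j) -> (forall j, f j <= f jx0) -> forall j,
    lo <= s / s' * f j + (lo - s / s' * f jn0) <= hi.
  move=> s'0 s0 s'E sE0 fn fx j; rewrite addrCA -mulrBr lerDl; apply/andP; split.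
    by rewrite mulr_ge0 ?subr_ge0 ?fn// divr_ge0// ltW.
  rewrite -lerBrDl -sE0 mulrAC ler_pdivrMr// ler_pM2l// s'E lerD2r; exact: fx.
have [L [L0 L1 LE]] : exists L : {ffun 'I_dA' -> bool} -> R,
    [/\ forall u, 0 <= L u, \sum_u L u = 1 &
    forall j, \sum_u L u * (if u j then p jx else p jn) = A * p' j + a0].
  apply: sign_average; first by rewrite -subr_gt0 -sE.
    by move=> j; have /andP[] := interp _ _ _ _ _ _ _ _ sA' sA sE' sE pn' px' j.
  by move=> j; have /andP[] := interp _ _ _ _ _ _ _ _ sA' sA sE' sE pn' px' j.
have [M [M0 M1 ME]] : exists M : {ffun 'I_dB' -> bool} -> R,
    [/\ forall v, 0 <= M v, \sum_v M v = 1 &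
    forall k, \sum_v M v * (if v k then q kx else q kn) = B * q' k + b0].
  apply: sign_average; first by rewrite -subr_gt0 -tE.
    by move=> j; have /andP[] := interp _ _ _ _ _ _ _ _ sB' sB tE' tE qn' qx' j.
  by move=> j; have /andP[] := interp _ _ _ _ _ _ _ _ sB' sB tE' tE qn' qx' j.
have [X [uX XE]] : exists X : bool -> 'M[C]_(dA * 1), (forall b, unitary_mx (X b)) /\
    forall b, X b *m ket0 R (dA * 1) =
      evec (U *t (1%:M : 'M[C]_1)) (mxtens_index (if b then jx else jn, ord0)).
  have [X1 uX1 X1E] := unitary_ket0 (mxtens_index (jx, ord0)) uU1.
  have [X2 uX2 X2E] := unitary_ket0 (mxtens_index (jn, ord0)) uU1.
  by exists (fun b => if b then X1 else X2); split; case.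
have [Y [uY YE]] : exists Y : bool -> 'M[C]_(dB * 1), (forall b, unitary_mx (Y b)) /\
    forall b, Y b *m ket0 R (dB * 1) =
      evec (V *t (1%:M : 'M[C]_1)) (mxtens_index (if b then kx else kn, ord0)).
  have [Y1 uY1 Y1E] := unitary_ket0 (mxtens_index (kx, ord0)) uV1.
  have [Y2 uY2 Y2E] := unitary_ket0 (mxtens_index (kn, ord0)) uV1.
  by exists (fun b => if b then Y1 else Y2); split; case.
pose T := t / (Kprod HA HB / Kprod HA' HB').
have T0 : 0 <= T by rewrite divr_ge0// ltW// divr_gt0.
have TAB : T * (A * B) = t.
  rewrite /T /A /B /Kprod; field.
  by rewrite ?(lt0r_neq0 sA, lt0r_neq0 sB, lt0r_neq0 sA', lt0r_neq0 sB').
pose CX (u : {ffun 'I_dA' -> bool}) := controlled U' (fun j => X (u j)).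
pose CY (v : {ffun 'I_dB' -> bool}) := controlled V' (fun k => Y (v k)).
have uCX u : unitary_mx (CX u) by apply: unitary_controlled.
have uCY v : unitary_mx (CY v) by apply: unitary_controlled.
(* Final local correction: [(A p' + a0) (B q' + b0)] exceeds [A B p' q'] by
   [A p' b0 + a0 (B q' + b0)], one term for each party. *)
pose FX := controlled U' (fun j => dgmx (fun _ : 'I_(dA * 1) =>
  cis (T * (A * p' j * b0)))).
pose FY := controlled V' (fun k => dgmx (fun _ : 'I_(dB * 1) =>
  cis (T * (a0 * (B * q' k + b0))))).
have uFX : unitary_mx FX by apply: unitary_controlled => // j; exact: unitary_cis.
have uFY : unitary_mx FY by apply: unitary_controlled => // j; exact: unitary_cis.
pose tau uv := T * (L uv.1 * M uv.2).
pose blk (uv : {ffun 'I_dA' -> bool} * {ffun 'I_dB' -> bool}) :=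
  [:: (0, (CX uv.1, CY uv.2)); (tau uv, (adjmx (CX uv.1), adjmx (CY uv.2)))].
pose ss := flatten [seq blk uv | uv <- index_enum _] ++ [:: (0, (FX, FY))].
(* One-dimensional ancillas suffice: the systems to be prepared are the resource systems [A] and
   [B], which start in [ket0]. *)
exists 1%N, 1%N, (1%:M, 1%:M), ss.
have tau_sum : \sum_uv tau uv = T.
  rewrite -mulr_sumr -(pair_big xpredT xpredT (fun u v => L u * M v)) /=.
  under eq_bigr do rewrite -mulr_sumr M1 mulr1.
  by rewrite L1 mulr1.
split; [|split].
- split; first exact: unitary_mx1.
  split; first exact: unitary_mx1.
  move=> s; rewrite mem_cat inE => /orP[/flatten_mapP[uv _]|/eqP ->]; last by [].
  rewrite !inE => /orP[/eqP ->|/eqP ->] /=; first by [].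
  split; last by split; exact: unitary_adj.
  by apply: mulr_ge0 => //; exact: mulr_ge0.
- rewrite /prot_time big_cat big_seq1 /= addr0 big_flatten big_map.
  under eq_bigr do rewrite !big_cons big_nil /= addr0 add0r.
  by rewrite tau_sum.
move=> i j k l; rewrite (@induced_channel_exact _ _ _ _ _ _ _ _ (evol (HA' *t HB') t)).
- by rewrite subrr normr0 ler0c ltW.
- by rewrite muln1.
- by rewrite muln1.
apply: (evec_ext uU' uV') => {i j k l} j k.
rewrite -!mulmxA (evol_tv _ _ _ dU' dV') -scalemxAr tens_tv !attach_mxE.
set Psi := tv (tv _ _) _.
pose ph (uv : {ffun 'I_dA' -> bool} * {ffun 'I_dB' -> bool}) :=
  tau uv * (p (if uv.1 j then jx else jn) * q (if uv.2 k then kx else kn)).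
(* The weights are products, so the average of the product of the selected eigenvalues is the
   product of their averages. *)
have phE : \sum_uv ph uv = T * ((A * p' j + a0) * (B * q' k + b0)).
  rewrite -LE -ME mulr_suml mulr_sumr.
  under [RHS]eq_bigr do rewrite mulr_sumr mulr_sumr.
  rewrite [RHS]pair_big /=; apply: eq_bigr => uv _.
  by rewrite /ph /tau (fun_if p) (fun_if q); ring.
have W0E : ((1%:M : 'M[C]_(dA' * (dA * 1))) *t (1%:M : 'M[C]_(dB' * (dB * 1)))) *m Psi =
    1 *: Psi by rewrite tens1mx1 mul1mx scale1r.
have dg_const n (z : C) (x : 'cV[C]_n) : dgmx (fun=> z) *m x = z *: x.
  by apply/colP => i; rewrite mul_dgmx mxE.
have blkE uv : step_op (HA *t HB) (tau uv, (adjmx (CX uv.1), adjmx (CY uv.2))) *m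
    (step_op (HA *t HB) (0, (CX uv.1, CY uv.2)) *m Psi) = cis (- ph uv) *: Psi.
  exact: (step_eigen (X := fun j => X (uv.1 j)) (Y := fun k => Y (uv.2 k))
    (tau uv) hA hB dU dV uU' uV' (uX _) (uY _) (XE _) (YE _)).
have FE : (FX *t FY) *m Psi =
    (cis (T * (A * p' j * b0)) * cis (T * (a0 * (B * q' k + b0)))) *: Psi.
  by rewrite tens_tv !controlled_tv// !dg_const !tvZr tvZl scalerA mulrC.
transitivity ((cis (- \sum_uv ph uv) * 1) *: (step_op (HA *t HB) (0, (FX, FY)) *m Psi)).
  exact: (foldl_eigen (blk := fun uv => ((0, (CX uv.1, CY uv.2)),
    (tau uv, (adjmx (CX uv.1), adjmx (CY uv.2))))) _ _ blkE W0E).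
rewrite step0// FE scalerA mulr1 phE; congr (_ *: _).
rewrite -!cisD; congr cis; rewrite -[in RHS]TAB; ring.
Qed.

End RateLower.

Lemma sim_rateE (R : realType) dA dB dA' dB' (HA : 'M[R[i]]_dA) (HB : 'M[R[i]]_dB)
    (HA' : 'M[R[i]]_dA') (HB' : 'M[R[i]]_dB') :
  herm_mx HA -> herm_mx HB -> herm_mx HA' -> herm_mx HB' ->
  nonlocal_ham (HA *t HB) -> nonlocal_ham (HA' *t HB') ->
  sim_rate (HA *t HB) (HA' *t HB') = Kprod HA HB / Kprod HA' HB'.
Proof.
move=> hA hB hA' hB' nl nl'; apply: sup_max_elt; first exact: rate_lower.
by move=> g; exact: rate_upper.
Qed.

Theorem theorem1 (R : realType) (dA dB dA' dB' : nat)
  (HA : 'M[R[i]]_dA) (HB : 'M[R[i]]_dB)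
  (HA' : 'M[R[i]]_dA') (HB' : 'M[R[i]]_dB') :
  herm_mx HA -> herm_mx HB -> herm_mx HA' -> herm_mx HB' ->
  nonlocal_ham (HA *t HB) -> nonlocal_ham (HA' *t HB') ->
  sim_rate (HA *t HB) (HA' *t HB') = Kprod HA HB / Kprod HA' HB' /\
  sim_rate (HA' *t HB') (HA *t HB) = Kprod HA' HB' / Kprod HA HB /\
  sim_rate (HA *t HB) (HA' *t HB') * sim_rate (HA' *t HB') (HA *t HB) = 1.
Proof.
move=> hA hB hA' hB' nl nl'; rewrite !sim_rateE//; do !split=> //.
have [_ _ sA sB] := nonlocal_spread hA hB nl.
have [_ _ sA' sB'] := nonlocal_spread hA' hB' nl'.
have K0 : Kprod HA HB != 0 by rewrite lt0r_neq0// divr_gt0// mulr_gt0.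
have K'0 : Kprod HA' HB' != 0 by rewrite lt0r_neq0// divr_gt0// mulr_gt0.
by rewrite mulrA divfK// divff.
Qed.
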